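(* Suppose that the finitely generated group $G$ acts by isometries on the relatively hyperbolic space $X$ permuting the peripheral sets. Suppose also that there are at least $2$ peripheral sets and that the stabiliser of each peripheral set has unbounded orbits. Let $\mu$ be a symmetric probability measure on $G$ whose finite support generates $G$ and let $\{X_n\}$ be the corresponding random walk, which we assume to make linear progress. Then for each $p\in X$ and for each $k\geq 1$ there exists $C$ so that, for each $n\geq 1$, $$\mathbb{P}\left[\sup_{[p,X_np]} d_{Haus}(\{X_ip\}_{i\leq n}, trans([p,X_np]))\geq C\log (n)\right]\leq Cn^{-k},$$ where the supremum is taken over all geodesics $[p,X_np]$ from $p$ to $X_np$. Moreover, the same is true with $[p,X_np]$ in place of $trans([p,X_np])$.
   Context: Relatively hyperbolic spaces. A complete geodesic metric space is tree-graded with respect to a collection of closed geodesic subspaces (pieces) if any two distinct pieces share at most one point and every simple geodesic triangle is contained in one piece. A geodesic metric space $X$ is hyperbolic relative to a collection $\mathcal{P}$ of subsets (peripheral sets) if every asymptotic cone of $X$ is tree-graded with respect to the collection of the non-empty ultralimits of sequences of elements of $\mathcal{P}$, where the limits of two sequences that are not almost surely equal count as distinct pieces. A relatively hyperbolic space is a geodesic space with such a collection $\mathcal{P}$. Random walk: $X_0=1$, $X_n=s_1\cdots s_n$ with $s_i$ independent with law $\mu$. A random walk $\{X_n\}$ on $G$ acting on the pointed metric space $(X,p)$ makes linear progress if there exists $C_0\geq 1$ so that $\mathbb{P}[d(p,X_np)\leq n/C_0]\leq C_0e^{-n/C_0}$ for all $n$. Transient points. For constants $\nu,R$ and a geodesic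 $\alpha$ in $X$, $deep_{\nu,R}(\alpha)$ is the set of points $q$ of $\alpha$ that belong to some subgeodesic $[x,y]$ of $\alpha$ with endpoints in the $\nu$-neighbourhood $N_\nu(P)$ of some $P\in\mathcal{P}$ and with $d(q,x),d(q,y)>R$; $trans_{\nu,R}(\alpha)=\alpha\setminus deep_{\nu,R}(\alpha)$. Let $\pi_P:X\to P$ be a coarse closest point projection: $d(x,\pi_P(x))\leq d(x,P)+1$. We write $trans$ for $trans_{\nu,R}$, where $\nu,R$ are fixed constants (which exist) for which there are $D,t,C'$ such that: (1) for all $x,y,z\in X$, $trans_{\nu,R}([x,y])\subseteq N_D(trans_{\nu,R}([x,z])\cup trans_{\nu,R}([z,y]))$; (2) $deep_{\nu,R}([x,y])$ is contained in a disjoint union of subgeodesics of $[x,y]$, each contained in $N_{t\nu}(P)$ for some $P\in\mathcal{P}$, called the deep component along $P$; (3) the endpoints of the deep component of $[x,y]$ along $P$ (if it exists) are $C'$-close to $\pi_P(x),\pi_P(y)$; (4) if $d(\pi_P(x),\pi_P(y))>C'$ then $[x,y]$ has a deep component along $P$ of length at least $d(\pi_P(x),\pi_P(y))-C'$. $d_{Haus}$ denotes the Hausdorff distance. *)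

(* Defs.v *)
From HB Require Export structures.
From mathcomp Require Export all_boot all_order all_algebra generic_quotient.
From mathcomp Require Export all_classical all_reals all_analysis.
Export Order.TTheory GRing.Theory Num.Theory numFieldNormedType.Exports.

Set Implicit Arguments.
Unset Strict Implicit.
Unset Printing Implicit Defensive.

Local Open Scope classical_set_scope.
Local Open Scope ring_scope.
Local Open Scope quotient_scope.

Section Metric.
Context (R : realType) (T : metricType R).
Implicit Types (x y z : T) (A B : set T) (g : R -> T).

(* Only the values of g on [0, d(x, y)] are relevant. *)
Definition geodesic x y g : Prop :=
  [/\ g 0 = x, g (mdist x y) = y &
      forall s t, 0 <= s <= mdist x y -> 0 <= t <= mdist x y ->
        mdist (g s) (g t) = `|s - t|].

Definition geodesic_seg x y g : set T := g @` `[0, mdist x y].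

Definition geodesic_space : Prop := forall x y, exists g, geodesic x y g.

Definition geodesic_subset A : Prop :=
  forall x y, A x -> A y ->
    exists2 g, geodesic x y g & geodesic_seg x y g `<=` A.

Definition complete_space : Prop :=
  forall F : set_system T, ProperFilter F -> cauchy F -> exists l : T, F --> l.

(* The sides of a geodesic triangle with distinct vertices form a simple loop
   iff any two of them only share their common vertex.  A geodesic bigon is
   covered by adding a vertex inside one of its sides. *)
Definition simple_geodesic_triangle x y z gxy gyz gzx : Prop :=
  [/\ [/\ x <> y, y <> z & z <> x],
      [/\ geodesic x y gxy, geodesic y z gyz & geodesic z x gzx] &
      [/\ geodesic_seg x y gxy `&` geodesic_seg y z gyz = [set y],
          geodesic_seg y z gyz `&` geodesic_seg z x gzx = [set z] &
          geodesic_seg z x gzx `&` geodesic_seg x y gxy = [set x]]].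

(* The pieces are indexed by D, where same i j says that i and j index the same
   piece: indices that are not the same count as distinct pieces even if
   piece i = piece j. *)
Definition tree_graded (I : Type) (D : set I) (same : I -> I -> Prop)
    (piece : I -> set T) : Prop :=
  [/\ complete_space /\ geodesic_space,
      forall i, D i -> closed (piece i) /\ geodesic_subset (piece i),
      forall i j, D i -> D j -> ~ same i j ->
        is_subset1 (piece i `&` piece j) &
      forall x y z gxy gyz gzx, simple_geodesic_triangle x y z gxy gyz gzx ->
        exists2 i, D i & geodesic_seg x y gxy `|` geodesic_seg y z gyz
                         `|` geodesic_seg z x gzx `<=` piece i].

(* N_r(A) = {x | d(x, A) < r} *)
Definition nbhd (r : R) A : set T := [set x | exists2 a, A a & mdist x a < r].

Definition dHaus A B : \bar R :=
  ereal_inf [set r%:E | r in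
    [set r | [/\ 0 <= r, A `<=` nbhd r B & B `<=` nbhd r A]]].

End Metric.

(* The choices on which an asymptotic cone depends *)
Record cone_data (R : realType) (X : metricType R) := ConeData {
  cultra : set_system nat ;
  cultraP : UltraFilter cultra ;
  cultra_nonprincipal : forall n, ~ cultra [set n] ;
  cbase : nat -> X ;
  cscale : nat -> R ;
  cscale_gt0 : forall n, 0 < cscale n ;
  cscale_pinfty : cscale @ cultra --> +oo }.

#[global] Existing Instance cultraP.

Section AsymptoticCone.
Context (R : realType) (X : metricType R) (c : cone_data X).
Let omega := cultra c.

Definition scaled_dist (x y : nat -> X) (n : nat) : R :=
  mdist (x n) (y n) / cscale c n.

Definition admissible (x : nat -> X) : Prop :=
  exists M : R, \forall n \near omega, scaled_dist x (cbase c) n <= M.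

Definition adm_seq := {x : nat -> X | `[< admissible x >]}.

Definition cone_eq (x y : adm_seq) : bool :=
  `[< scaled_dist (val x) (val y) @ omega --> (0 : R) >].

Lemma scaled_dist_ge0 x y n : 0 <= scaled_dist x y n.
Proof. by rewrite divr_ge0 ?mdist_ge0// ltW// cscale_gt0. Qed.

Lemma scaled_distxx x : scaled_dist x x = cst 0.
Proof. by apply/funext => n; rewrite /scaled_dist mdistxx mul0r. Qed.

Lemma scaled_distC x y : scaled_dist x y = scaled_dist y x.
Proof. by apply/funext => n; rewrite /scaled_dist metric_sym. Qed.

Lemma scaled_dist_triangle y x z n :
  scaled_dist x z n <= scaled_dist x y n + scaled_dist y z n.
Proof.
rewrite /scaled_dist -mulrDl ler_wpM2r ?metric_triangle//.
by rewrite invr_ge0 ltW// cscale_gt0.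
Qed.

Lemma ultra_bounded_cvg (f : nat -> R) (M : R) :
  (\forall n \near omega, 0 <= f n <= M) -> cvg (f @ omega).
Proof.
move=> fM.
have FF : ProperFilter (f @ omega) by exact: fmap_proper_filter.
have fI : (f @ omega) `[0, M]%classic.
  by move: fM; apply: filterS => n /=; rewrite in_itv.
have [l [_ ll]] := @segment_compact R 0 M _ FF fI.
apply/cvg_ex; exists l => U lU.
have [//|nU] := in_ultra_setVsetC (f @^-1` U) (cultraP c).
have [z []] := ll (~` U) U nU lU.
by [].
Qed.

Lemma scaled_dist_cvg (x y : adm_seq) :
  cvg (scaled_dist (val x) (val y) @ omega).
Proof.
case: x => x /= /asboolP[M xM]; case: y => y /= /asboolP[N yN].
apply: (@ultra_bounded_cvg _ (M + N)).
move: xM yN; apply: filterS2 => n xM yN.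
rewrite scaled_dist_ge0/= (le_trans (scaled_dist_triangle (cbase c) _ _ _))//.
by rewrite lerD// scaled_distC.
Qed.

Lemma cone_eq_refl : reflexive cone_eq.
Proof. by move=> x; apply/asboolP; rewrite scaled_distxx; exact: cvg_cst. Qed.

Lemma cone_eq_sym : symmetric cone_eq.
Proof. by move=> x y; rewrite /cone_eq scaled_distC. Qed.

Lemma cone_eq_trans : transitive cone_eq.
Proof.
move=> y x z /asboolP xy /asboolP yz; apply/asboolP.
apply: (@squeeze_cvgr _ _ _ _ (cst 0)
  (fun n => scaled_dist (val x) (val y) n + scaled_dist (val y) (val z) n)).
- apply: nearW => n.
  by rewrite scaled_dist_ge0/= scaled_dist_triangle.
- exact: cvg_cst.
- by rewrite -[0 in X in _ --> X]addr0; exact: cvgD.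
Qed.

Canonical cone_equiv := EquivRel cone_eq cone_eq_refl cone_eq_sym cone_eq_trans.

Definition cone : Type := {eq_quot cone_equiv}.
HB.instance Definition _ := Choice.on cone.
HB.instance Definition _ := EqQuotient.on cone.

Definition cone_dist (u v : cone) : R :=
  lim (scaled_dist (val (repr u)) (val (repr v)) @ omega).

Lemma cone_distxx u : cone_dist u u = 0.
Proof. by rewrite /cone_dist scaled_distxx; exact: lim_cst. Qed.

Lemma cone_dist_positivity u v : cone_dist u v = 0 -> u = v.
Proof.
move=> uv0; rewrite -[u]reprK -[v]reprK; apply/eqP; rewrite eqmodE.
apply/asboolP; rewrite -uv0; exact: scaled_dist_cvg.
Qed.

Lemma cone_dist_sym u v : cone_dist u v = cone_dist v u.
Proof. by rewrite /cone_dist scaled_distC. Qed.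

Lemma cone_dist_triangle v u w :
  cone_dist u w <= cone_dist u v + cone_dist v w.
Proof.
rewrite /cone_dist -limD; [|exact: scaled_dist_cvg..].
apply: ler_lim; [exact: scaled_dist_cvg|apply: is_cvgD; exact: scaled_dist_cvg|].
by apply: nearW => n; exact: scaled_dist_triangle.
Qed.

HB.instance Definition _ := isMetric.Build R cone
  cone_distxx cone_dist_positivity cone_dist_sym cone_dist_triangle.

Definition ultralimit (A : nat -> set X) : set cone :=
  [set u | exists x : adm_seq,
     u = \pi_cone x /\ \forall n \near omega, A n (val x n)].

End AsymptoticCone.

Arguments ultralimit {R X} c A.

Section RelativelyHyperbolic.
Context (R : realType) (X : metricType R).
Implicit Types (PP : set (set X)) (x y z p : X) (g : R -> X).

Definition relatively_hyperbolic PP : Prop :=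
  geodesic_space X /\
  forall c : cone_data X,
    @tree_graded R (cone c) (nat -> set X)
      [set A | (forall n, PP (A n)) /\ ultralimit c A !=set0]
      (fun A B => \forall n \near cultra c, A n = B n)
      (ultralimit c).

Definition deep PP (nu rho : R) x y g : set X :=
  [set q | exists P a b t,
    [/\ PP P, [/\ 0 <= a, a <= t, t <= b & b <= mdist x y], q = g t,
        nbhd nu P (g a) /\ nbhd nu P (g b) &
        rho < mdist q (g a) /\ rho < mdist q (g b)]].

Definition trans PP (nu rho : R) x y g : set X :=
  geodesic_seg x y g `\` deep PP nu rho x y g.

(* The first conjunct makes every peripheral set nonempty. *)
Definition coarse_projection PP (proj : set X -> X -> X) : Prop :=
  forall P x, PP P ->
    P (proj P x) /\ mdist x (proj P x) <= inf (mdist x @` P) + 1.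

(* Q is the set of the peripheral sets P along which the geodesic g from x to y
   has a deep component, which is then the subgeodesic g([a P, b P]). *)
Definition deep_components PP proj (nu rho t C : R) x y g
    (Q : set (set X)) (a b : set X -> R) : Prop :=
  [/\ Q `<=` PP,
      [/\ forall P, Q P ->
            [/\ 0 <= a P, a P <= b P, b P <= mdist x y &
                g @` `[a P, b P] `<=` nbhd (t * nu) P],
          trivIset Q (fun P => g @` `[a P, b P]) &
          deep PP nu rho x y g `<=` \bigcup_(P in Q) (g @` `[a P, b P])],
      forall P, Q P ->
        mdist (g (a P)) (proj P x) <= C /\ mdist (g (b P)) (proj P y) <= C &
      forall P, PP P -> C < mdist (proj P x) (proj P y) ->
        Q P /\ mdist (proj P x) (proj P y) - C <= mdist (g (a P)) (g (b P))].

Definition trans_constants PP proj (nu rho : R) : Prop :=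
  [/\ 0 <= nu, 0 <= rho &
      exists D t C : R,
        (forall x y z gxy gxz gzy,
           geodesic x y gxy -> geodesic x z gxz -> geodesic z y gzy ->
           trans PP nu rho x y gxy `<=`
             nbhd D (trans PP nu rho x z gxz `|` trans PP nu rho z y gzy)) /\
        (forall x y g, geodesic x y g ->
           exists Q a b, deep_components PP proj nu rho t C x y g Q a b)].

End RelativelyHyperbolic.

Section Groups.
Context (R : realType) (G : groupType).
Local Open Scope group_scope.

Definition generates (S : set G) : Prop :=
  forall H : {pred G}, group_closed H -> (forall h, S h -> h \in H) ->
    forall h, h \in H.

Definition finitely_generated : Prop :=
  exists2 S : set G, finite_set S & generates S.

Definition isometric_action (X : metricType R) (act : G -> X -> X) : Prop :=
  [/\ forall x, act 1 x = x, forall g h x, act (g * h) x = act g (act h x) &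
      forall g x y, mdist (act g x) (act g y) = mdist x y].

Definition stabiliser (X : metricType R) (act : G -> X -> X) (A : set X) :
  set G := [set g | act g @` A = A].

Definition unbounded_orbits (X : metricType R) (act : G -> X -> X)
    (H : set G) : Prop :=
  forall x (M : R), exists2 h, H h & (M < mdist x (act h x))%R.

Definition msupport (mu : G -> R) : set G := [set g | mu g != 0%R].

(* mu is the probability mass function of the measure. *)
Definition fin_supp_probability (mu : G -> R) : Prop :=
  [/\ forall g, (0 <= mu g)%R, finite_set (msupport mu) &
      (\sum_(g \in [set: G]) mu g = 1)%R].

(* G carries its discrete sigma-algebra. *)
Definition iid_with_law d (Omega : measurableType d) (P : probability Omega R)
    (mu : G -> R) (s : nat -> Omega -> G) : Prop :=
  [/\ forall i (A : set G), measurable (s i @^-1` A),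
      forall i g, P (s i @^-1` [set g]) = (mu g)%:E &
      forall (J : seq nat) (A : nat -> set G), uniq J ->
        P (\big[setI/setT]_(i <- J) (s i @^-1` A i)) =
        (\prod_(i <- J) P (s i @^-1` A i))%E].

(* The increments are numbered from 0: X_n = s_0 s_1 ... s_(n-1). *)
Definition rwalk (Omega : Type) (s : nat -> Omega -> G) (n : nat) (w : Omega) :
  G := \prod_(i < n) s i w.

Definition linear_progress d (Omega : measurableType d)
    (P : probability Omega R) (X : metricType R) (act : G -> X -> X)
    (Xn : nat -> Omega -> G) (p : X) : Prop :=
  exists2 C0 : R, (1 <= C0)%R & forall n,
    (P [set w | (mdist p (act (Xn n w) p) <= n%:R / C0)%R]
       <= (C0 * expR (- (n%:R / C0)))%:E)%E.

End Groups.

Arguments rwalk {G Omega}.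

(* Main.v *)
Require Import Defs.
From mathcomp Require Import ring lra zify.

Set Implicit Arguments.
Unset Strict Implicit.
Unset Printing Implicit Defensive.

Local Open Scope classical_set_scope.
Local Open Scope ring_scope.

(* The tracking estimate only uses conditions (1)-(4) on transient points, not the
   asymptotic cones. For an orbit point gp and a peripheral set P, consider the
   distance between the projections to P of p and gp.

   Deep components along distinct peripheral sets are disjoint. Hence among
   peripheral sets at comparable distance from p at most one can see a large
   projection of a given gp. Averaging over a window of m steps, during which the
   walk visits translates of P without spending more than 2/5 of its time at any
   one of them, shows that for all P and n the projection of X_n p stays within a
   uniform distance K of the projection of p with probability at least 3/5. Since
   2/5 < 3/5, this self-improves to an exponential tail. Every P with a large
   projection becomes visible along the walk as one of linearly many candidates,
   so with high probability all projections of X_n p are O(log n).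

   Condition (1), iterated dyadically, places the transient points at distance
   O(log n) from the walk; long runs of deep points are excluded by the bound on
   projections, so the whole geodesic is near the walk. Conversely, X_i p lies
   between two points of the walk that are near a common point of the geodesic,
   and by linear progress these are at most O(log n) steps apart. *)

(** * Geodesics and projections to peripheral sets *)

Section Geodesics.
Context (R : realType) (X : metricType R).
Implicit Types (x y : X) (g : R -> X).

Lemma geodesic_dist x y g s t : geodesic x y g ->
  0 <= s -> s <= t -> t <= mdist x y -> mdist (g s) (g t) = t - s.
Proof.
move=> [_ _ gst] s0 st tl; rewrite gst; last 2 first.
- by apply/andP; split; lra.
- by apply/andP; split; lra.
by rewrite distrC ger0_norm// subr_ge0.
Qed.

Lemma geodesic_distl x y g t : geodesic x y g ->
  0 <= t -> t <= mdist x y -> mdist x (g t) = t.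
Proof.
move=> gg t0 tl; have [g0 _ _] := gg.
by rewrite -[x in LHS]g0 (geodesic_dist gg)// subr0.
Qed.

Lemma geodesic_distr x y g t : geodesic x y g ->
  0 <= t -> t <= mdist x y -> mdist (g t) y = mdist x y - t.
Proof.
move=> gg t0 tl; have [_ g1 _] := gg.
by rewrite -[y in LHS]g1 (geodesic_dist gg).
Qed.

End Geodesics.

(* The content of conditions (2)-(4) on deep components, with the components
   described by intervals of parameters. *)
Definition components (R : realType) (X : metricType R) (PP : set (set X))
    (proj : set X -> X -> X) (nu rho c : R) x y g
    (Q : set (set X)) (a b : set X -> R) : Prop :=
  [/\ forall P, Q P -> [/\ PP P, 0 <= a P, a P <= b P & b P <= mdist x y],
      forall P P', Q P -> Q P' -> P <> P' -> b P < a P' \/ b P' < a P,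
      forall t, 0 <= t <= mdist x y -> deep PP nu rho x y g (g t) ->
        exists2 P, Q P & a P <= t <= b P,
      forall P, Q P ->
        mdist (g (a P)) (proj P x) <= c /\ mdist (g (b P)) (proj P y) <= c &
      forall P, PP P -> c < mdist (proj P x) (proj P y) ->
        Q P /\ mdist (proj P x) (proj P y) - c <= b P - a P].

(** A geodesic is injective, its parameter being the distance from [x]; hence disjoint subsegments
    come from disjoint parameter intervals. *)
Lemma deep_components_components (R : realType) (X : metricType R)
    (PP : set (set X)) proj (nu rho t C c : R) x y g Q a b :
  C <= c -> geodesic x y g ->
  deep_components PP proj nu rho t C x y g Q a b ->
  components PP proj nu rho c x y g Q a b.
Proof.
move=> Cc gg [QP [Qab Qtriv Qdeep] Qproj Qlong]; split.
- by move=> P QPP; have [? ? ? _] := Qab _ QPP; split => //; exact: QP.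
- move=> P P' QPP QP' PP'.
  have [? ? ? _] := Qab _ QPP; have [? ? ? _] := Qab _ QP'.
  have [lt1|le1] := ltP (b P) (a P'); first by left.
  have [lt2|le2] := ltP (b P') (a P); first by right.
  exfalso; apply: PP'; apply: Qtriv => //.
  (* Overlapping intervals share the larger of their left endpoints. *)
  exists (g (Num.max (a P) (a P'))); split => /=;
    exists (Num.max (a P) (a P')) => //=.
  + by rewrite in_itv/= le_max lexx/= ge_max le1; apply/andP.
  + by rewrite in_itv/= le_max lexx orbT/= ge_max le2; apply/andP.
- move=> s /andP[s0 sl] /Qdeep[P QPP [r /=]]; rewrite in_itv/= => /andP[ar rb] grs.
  exists P => //; have [? ? ? _] := Qab _ QPP.
  have := geodesic_distl gg s0 sl; rewrite -grs (geodesic_distl gg); last 2 first.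
  + lra.
  + lra.
  by move=> <-; apply/andP.
- by move=> P /Qproj[? ?]; split; lra.
- move=> P PPP lt1;
    have [QPP len] : Q P /\ mdist (proj P x) (proj P y) - C <= mdist (g (a P))
      (g (b P)).
    by apply: Qlong => //; lra.
  split => //; have [? ? ? _] := Qab _ QPP.
  by move: len; rewrite (geodesic_dist gg)//; lra.
Qed.

(** The interface for the geometric arguments: one constant [c] bounds the errors in conditions
    (2)-(4), and near-minimality is tested against each point of [P] instead of an infimum. *)
Record projection_system (R : realType) (X : metricType R) (PP : set (set X))
    (proj : set X -> X -> X) (nu rho c : R) : Prop := {
  ps_geodesic : geodesic_space X ;
  ps_ge0 : 0 <= c ;
  ps_mem : forall P x, PP P -> P (proj P x) ;
  ps_min : forall P x y, PP P -> P y -> mdist x (proj P x) <= mdist x y + 1 ;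
  ps_components : forall x y g, geodesic x y g ->
    exists Q a b, components PP proj nu rho c x y g Q a b }.

Section Projections.
Context (R : realType) (X : metricType R) (PP : set (set X)).
Context (proj : set X -> X -> X) (nu rho c : R).
Context (ps : projection_system PP proj nu rho c).
Implicit Types (x y z : X) (P Q : set X).

Lemma proj_mem P x : PP P -> P x -> mdist x (proj P x) <= 1.
Proof. by move=> PPP Px; have := ps_min ps x PPP Px; rewrite mdistxx add0r. Qed.

(** A projection distance above [c] forces a component of almost that length inside a geodesic from
    [x] to [y]. *)
Lemma proj_lipschitz P x y : PP P ->
  mdist (proj P x) (proj P y) <= mdist x y + c.
Proof.
move=> PPP; have xy0 := mdist_ge0 x y; have c0 := ps_ge0 ps.
have [le1|lt1] := leP (mdist (proj P x) (proj P y)) c; first by lra.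
have [g gg] := ps_geodesic ps x y.
have [Q [a [b [Qab _ _ _ Qlong]]]] := ps_components ps gg.
have [QPP ?] := Qlong _ PPP lt1.
by have [_ ? ? ?] := Qab _ QPP; lra.
Qed.

(** If the projections of [x] and [y] are far apart, a geodesic to [y] passes close to [proj P x];
    as [y] is almost closest to [x], at most [c + 1] of the geodesic remains after that. *)
Lemma proj_unique P x y : PP P -> P y ->
  (forall z, P z -> mdist x y <= mdist x z + 1) ->
  mdist y (proj P x) <= 2 * c + 1.
Proof.
move=> PPP Py ymin; have c0 := ps_ge0 ps.
have [le1|lt1] := leP (mdist (proj P x) (proj P y)) c.
  have := proj_mem PPP Py.
  have := metric_triangle y (proj P y) (proj P x).
  by rewrite (metric_sym (proj P y) (proj P x)); lra.
have [g gg] := ps_geodesic ps x y.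
have [Q [a [b [Qab _ _ Qproj Qlong]]]] := ps_components ps gg.
have [QPP len] := Qlong _ PPP lt1.
have [_ a0 ab bl] := Qab _ QPP; have [pa _] := Qproj _ QPP.
have al : a P <= mdist x y by lra.
have := metric_triangle x (g (a P)) (proj P x).
have := ymin _ (ps_mem ps x PPP).
have := metric_triangle y (g (a P)) (proj P x).
have := geodesic_distl gg a0 al; have := geodesic_distr gg a0 al.
by rewrite (metric_sym (g (a P)) y); lra.
Qed.

(** The component along [Q] covers all but two ends of length at most [c + 1], and the disjoint
    component along [P] has to fit into one of these ends. *)
Lemma proj_other P Q x y : PP P -> PP Q -> P <> Q -> Q x -> Q y ->
  mdist (proj P x) (proj P y) <= 2 * c + 2.
Proof.
move=> PPP PPQ PQ Qx Qy.
have xy0 := mdist_ge0 x y; have c0 := ps_ge0 ps.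
have [le1|lt1] := leP (mdist (proj P x) (proj P y)) c; first by lra.
have lip := proj_lipschitz x y PPP.
have qx := proj_mem PPQ Qx; have qy := proj_mem PPQ Qy.
(* Without a long component along [Q], the points [x] and [y] are themselves within [c + 2]. *)
have [le2|lt2] := leP (mdist (proj Q x) (proj Q y)) c.
  have := metric_triangle x (proj Q x) y.
  have := metric_triangle (proj Q x) (proj Q y) y.
  by rewrite (metric_sym (proj Q y) y); lra.
have [g gg] := ps_geodesic ps x y.
have [S [a [b [Qab Qdis _ Qproj Qlong]]]] := ps_components ps gg.
have [SP lenP] := Qlong _ PPP lt1.
have [SQ lenQ] := Qlong _ PPQ lt2.
have [_ a0P abP bP] := Qab _ SP; have [_ a0Q abQ bQ] := Qab _ SQ.
have [qa qb] := Qproj _ SQ.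
have aQl : a Q <= mdist x y by lra.
have bQ0 : 0 <= b Q by lra.
have := metric_triangle x (proj Q x) (g (a Q)).
have := metric_triangle (g (b Q)) (proj Q y) y.
rewrite (metric_sym (proj Q x) (g (a Q))) (metric_sym (proj Q y) y).
rewrite (geodesic_distl gg a0Q aQl) (geodesic_distr gg bQ0 bQ).
by have [] := Qdis _ _ SP SQ PQ; lra.
Qed.

(** The two components start at parameters that differ by at most [r + 2 * c] and are both longer
    than that, so they would overlap. *)
Lemma proj_exclusive P Q x y (r : R) : PP P -> PP Q -> P <> Q ->
  `|mdist x (proj P x) - mdist x (proj Q x)| <= r ->
  r + 3 * c < mdist (proj P x) (proj P y) ->
  r + 3 * c < mdist (proj Q x) (proj Q y) -> False.
Proof.
move=> PPP PPQ PQ xr Pr Qr; have c0 := ps_ge0 ps.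
have r0 : 0 <= r by exact: le_trans xr.
have [g gg] := ps_geodesic ps x y.
have [S [a [b [Qab Qdis _ Qproj Qlong]]]] := ps_components ps gg.
have cP : c < mdist (proj P x) (proj P y) by lra.
have cQ : c < mdist (proj Q x) (proj Q y) by lra.
have [SP lenP] := Qlong _ PPP cP.
have [SQ lenQ] := Qlong _ PPQ cQ.
have [_ a0P abP bP] := Qab _ SP; have [_ a0Q abQ bQ] := Qab _ SQ.
have [pa _] := Qproj _ SP; have [qa _] := Qproj _ SQ.
have aQl : a Q <= mdist x y by lra.
have aPl : a P <= mdist x y by lra.
have := metric_triangle x (proj Q x) (g (a Q)).
have := metric_triangle x (proj P x) (g (a P)).
have := metric_triangle x (g (a P)) (proj P x).
have := metric_triangle x (g (a Q)) (proj Q x).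
rewrite (metric_sym (proj Q x) (g (a Q))) (metric_sym (proj P x) (g (a P))).
rewrite (geodesic_distl gg a0Q aQl) (geodesic_distl gg a0P aPl).
move: xr; rewrite ler_norml => /andP[? ?].
by have [] := Qdis _ _ SP SQ PQ; lra.
Qed.

(* Components are disjoint, so one of length at least 1 is determined by an
   integer parameter that it contains. *)
Lemma long_components x y : exists F : nat -> set X,
  forall P, PP P -> c + 1 < mdist (proj P x) (proj P y) ->
    exists2 k : nat, k%:R <= mdist x y & F k = P.
Proof.
have [g gg] := ps_geodesic ps x y; have c0 := ps_ge0 ps.
have [S [a [b [Qab Qdis _ Qproj Qlong]]]] := ps_components ps gg.
pose good k P := S P /\ a P <= k%:R <= b P.
exists (fun k => xget set0 (good k)) => P PPP cP.
have cP' : c < mdist (proj P x) (proj P y) by lra.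
have [SP lenP] := Qlong _ PPP cP'.
have [_ a0P abP bP] := Qab _ SP.
have bP0 : 0 <= b P by lra.
have := truncn_itv bP0 => /andP[kl kr].
(* The component is longer than 1, so the integer part of its right endpoint still lies in it. *)
exists (Num.truncn (b P)); first by lra.
have gP : good (Num.truncn (b P)) P.
  split => //; rewrite kl andbT.
  by move: kr; rewrite -natr1; lra.
case: xgetP => [Q _ [SQ /andP[? ?]]|/(_ P)//].
apply: contrapT => /Qdis-/(_ SQ SP)[]; case: gP => _ /andP[]; lra.
Qed.

End Projections.

(** * Transient points and paths *)

Section Intervals.
Context (R : realType) (I : Type) (D : set I) (a b : I -> R).
Hypothesis disj : forall i j, D i -> D j -> i <> j -> b i < a j \/ b j < a i.

Let covered u v := forall t, u <= t <= v -> exists2 i, D i & a i <= t <= b i.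
Let split u v := forall i, D i -> ~ (a i <= u /\ v <= b i).

(** An end outside piece [i] lies in another piece [j]. Cutting in the middle of the gap between [j]
    and [i] leaves an interval with one end in [j] and the other outside [j], so that no single
    piece covers it. *)
Let split_avoid u v i : D i -> u <= v -> covered u v -> split u v ->
  exists u' v', [/\ u <= u', u' <= v', v' <= v, split u' v' &
                    v' < a i \/ b i < u'].
Proof.
move=> Di uv cov spl.
have [vai|aiv] := ltP v (a i); first by exists u, v; split => //; left.
have [biu|ubi] := ltP (b i) u; first by exists u, v; split => //; right.
have [uai|aiu] := ltP u (a i).
  have [|j Dj /andP[aju ubj]] := cov u; first by rewrite lexx.
  have ji : b j < a i.
    have [|//|] := disj Dj Di; last lra.
    by move=> ji; move: aju uai; rewrite ji; lra.
  exists u, ((b j + a i) / 2); split; [by []|lra|lra| |left; lra].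
  move=> k Dk [aku vbk]; have kj : k = j.
    by apply: contrapT => /disj-/(_ Dk Dj)[]; lra.
  by move: vbk; rewrite kj; lra.
have [biv|vbi] := ltP (b i) v; last by exfalso; apply: (spl i).
have [|j Dj /andP[ajv vbj]] := cov v; first by rewrite lexx uv.
have ij : b i < a j.
  have [|bjai|//] := disj Dj Di; last lra.
  by move=> ji; move: vbj biv; rewrite ji; lra.
exists ((b i + a j) / 2), v; split; [lra|lra|by []| |right; lra].
move=> k Dk [aku vbk]; have kj : k = j.
  by apply: contrapT => /disj-/(_ Dk Dj)[]; lra.
by move: aku; rewrite kj; lra.
Qed.

(* Sierpinski's theorem for an interval: otherwise one could shrink it
   successively so as to avoid each of the countably many pieces, without ever
   entering a single piece. *)
Lemma countable_disjoint_segments u v : countable D -> u <= v -> covered u v ->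
  exists2 i, D i & a i <= u /\ v <= b i.
Proof.
move=> /countable_injP[f finj] uv cov; apply: contrapT => nocov.
have spl : split u v by move=> i Di ai; apply: nocov; exists i.
pose ok (q : R * R) := [/\ u <= q.1, q.1 <= q.2, q.2 <= v & split q.1 q.2].
pose next (z : nat * (R * R)) (q : R * R) := ok z.2 ->
  [/\ ok q, z.2.1 <= q.1, q.2 <= z.2.2 &
    forall i, D i -> f i = z.1 -> q.2 < a i \/ b i < q.1].
have [F HF] : {F & forall z, next z (F z)}.
  apply: (@choice _ _ next) => -[n [x y]]; rewrite /next /ok/=.
  have [[i [Di fin]]|noi] := pselect (exists i, D i /\ f i = n); last first.
    exists (x, y) => /= okq; split => //= i Di fin.
    by exfalso; apply: noi; exists i.
  have [okq|] := pselect (ok (x, y)); last by exists (x, y).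
  have [/= ux xy yv sxy] := okq.
  have covxy : covered x y by move=> t /andP[? ?]; apply: cov; apply/andP;
    split; lra.
  have [x' [y' [xx' xy' yy' sxy' iav]]] := split_avoid Di xy covxy sxy.
  exists (x', y') => /= _; split => //=; first by split => //=; lra.
  move=> j Dj fjn; suff -> : j = i by [].
  by apply: finj; rewrite ?inE// fjn fin.
pose q := fix q n := if n is m.+1 then F (m, q m) else (u, v).
have qok n : ok (q n).
  elim: n => [|n /= qn]; first by split.
  by have [] := HF (n, q n) qn.
have qS n : (q n).1 <= (q n.+1).1 /\ (q n.+1).2 <= (q n).2.
  by have [_ ? ? _] := HF (n, q n) (qok n).
have q1 m n : (m <= n)%N -> (q m).1 <= (q n).1.
  elim: n => [|n IH]; first by rewrite leqn0 => /eqP ->.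
  rewrite leq_eqVlt => /predU1P[->//|]; rewrite ltnS => /IH.
  by have [] := qS n; lra.
have q2 m n : (m <= n)%N -> (q n).2 <= (q m).2.
  elim: n => [|n IH]; first by rewrite leqn0 => /eqP ->.
  rewrite leq_eqVlt => /predU1P[->//|]; rewrite ltnS => /IH.
  by have [] := qS n; lra.
(* The supremum of the left ends lies in all the nested intervals, but the piece [i] that covers it
   was avoided at stage [f i]. *)
pose A := [set (q n).1 | n in [set: nat]].
have Aub n : ubound A (q n).2.
  move=> _ [m _ <-]; have [_ ? _ _] := qok (maxn m n).
  have := q1 _ _ (leq_maxl m n); have := q2 _ _ (leq_maxr m n); lra.
have A0 : A !=set0 by exists (q 0%N).1, 0%N.
have supl n : (q n).1 <= sup A.
  by apply: ub_le_sup; [exists (q 0%N).2; exact: Aub|exists n].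
have supr n : sup A <= (q n).2 by apply: ge_sup => //; exact: Aub.
have [|i Di /andP[ai bi]] := cov (sup A).
  by have := supl 0%N; have := supr 0%N; rewrite /= => -> ->.
have [_ _ _ /(_ i Di erefl)] := HF (f i, q (f i)) (qok _).
by have := supl (f i).+1; have := supr (f i).+1; rewrite /=; lra.
Qed.

End Intervals.

Section TransientPoints.
Context (R : realType) (X : metricType R) (PP : set (set X)).
Context (proj : set X -> X -> X) (nu rho c : R).
Hypothesis ps : projection_system PP proj nu rho c.
Hypothesis rho0 : 0 <= rho.
Hypothesis PPcountable : countable PP.

Lemma transl x y g : geodesic x y g -> trans PP nu rho x y g (g 0).
Proof.
move=> gg; have xy0 := mdist_ge0 x y; split.
  by exists 0; rewrite //= in_itv/= lexx.
move=> [P [a [b [t [_ [a0 atl tb bl] gt _ [rhoa _]]]]]].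
have tl : t <= mdist x y by lra.
have t0 : 0 <= t by lra.
have := geodesic_dist gg (lexx 0) t0 tl; rewrite gt mdistxx => t00.
move: rhoa; rewrite gt (_ : a = t) ?mdistxx; last lra.
by rewrite ltNge rho0.
Qed.

Lemma transr x y g : geodesic x y g -> trans PP nu rho x y g (g (mdist x y)).
Proof.
move=> gg; have xy0 := mdist_ge0 x y; split.
  by exists (mdist x y); rewrite //= in_itv/= lexx xy0.
move=> [P [a [b [t [_ [a0 atl tb bl] gt _ [_ rhob]]]]]].
have tl : t <= mdist x y by lra.
have t0 : 0 <= t by lra.
have := geodesic_dist gg t0 tl (lexx _); rewrite gt mdistxx => t00.
move: rhob; rewrite gt (_ : b = t) ?mdistxx; last lra.
by rewrite ltNge rho0.
Qed.

(* A long run of deep points lies in a single deep component, whose length is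
   controlled by the projections of the endpoints. *)
Lemma geodesic_near_trans x y g (l t : R) : 0 <= l -> geodesic x y g ->
  (forall P, PP P -> mdist (proj P x) (proj P y) <= l) ->
  0 <= t <= mdist x y ->
  exists2 q, trans PP nu rho x y g q & mdist (g t) q <= l + 2 * c + 1.
Proof.
move=> l0 gg xyl /andP[t0 tl]; have c0 := ps_ge0 ps.
(* A component containing [[t - M, t + M]] would have length at least [2 * M], whereas the
   projections only allow [l + 2 * c]. *)
pose M := l + 2 * c + 1; have [M0 M2] : 0 <= M /\ l + 2 * c < 2 * M.
  by rewrite /M; split; lra.
apply: contrapT => notrans.
have far q : trans PP nu rho x y g q -> M < mdist (g t) q.
  by move=> tq; rewrite ltNge; apply/negP => le1; apply: notrans; exists q.
have Mt : M <= t.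
  have := far _ (transl gg); rewrite metric_sym (geodesic_dist gg)// subr0.
  exact: ltW.
have tM : t + M <= mdist x y.
  have := far _ (transr gg); rewrite (geodesic_dist gg)//; lra.
have [Q [a [b [Qab Qdis Qdeep Qproj _]]]] := ps_components ps gg.
have cov s : t - M <= s <= t + M -> exists2 P, Q P & a P <= s <= b P.
  move=> /andP[s1 s2]; have s0 : 0 <= s by lra.
  have sl : s <= mdist x y by lra.
  apply: Qdeep; first by rewrite s0.
  apply: contrapT => ndeep.
  have /far : trans PP nu rho x y g (g s).
    by split => //; exists s => //=; rewrite in_itv/= s0.
  have [st|ts] := leP s t.
    by rewrite metric_sym (geodesic_dist gg)//; lra.
  by rewrite (geodesic_dist gg)//; lra.
have [||P QP [aP bP]] := countable_disjoint_segments Qdis _ _ cov.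
- by apply: sub_countable PPcountable; apply: subset_card_le => P /Qab[].
- lra.
have [PPP aP0 abP bPl] := Qab _ QP; have [pa pb] := Qproj _ QP.
have := xyl _ PPP; have := geodesic_dist gg aP0 abP bPl.
have := metric_triangle (g (a P)) (proj P x) (g (b P)).
have := metric_triangle (proj P x) (proj P y) (g (b P)).
by rewrite (metric_sym (proj P y) (g (b P))); lra.
Qed.

End TransientPoints.

Section Paths.
Context (R : realType) (X : metricType R) (PP : set (set X)).
Context (nu rho D L : R) (f : nat -> X).
Hypothesis fL : forall j, mdist (f j) (f j.+1) <= L.

Lemma path_lipschitz i m : mdist (f i) (f (i + m)%N) <= L * m%:R.
Proof.
elim: m => [|m IH]; first by rewrite addn0 mdistxx mulr0.
rewrite addnS -natr1 mulrDr mulr1.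
have := metric_triangle (f i) (f (i + m)%N) (f (i + m).+1); have := fL (i + m).
lra.
Qed.

(** Each halving of the path costs one use of thinness, hence [D]; after [r] halvings at most one
    step is left, whose geodesic has length at most [L]. *)
Lemma trans_near_path r N i g q : geodesic_space X -> 0 <= D ->
  (forall x y z gxy gxz gzy,
     geodesic x y gxy -> geodesic x z gxz -> geodesic z y gzy ->
     trans PP nu rho x y gxy `<=`
       nbhd D (trans PP nu rho x z gxz `|` trans PP nu rho z y gzy)) ->
  (N <= 2 ^ r)%N -> geodesic (f i) (f (i + N)%N) g ->
  trans PP nu rho (f i) (f (i + N)%N) g q ->
  exists2 j, (i <= j <= i + N)%N & mdist q (f j) <= r%:R * D + L.
Proof.
move=> geoX D0 thin; elim: r N i g q => [|r IH] N i g q Nr gg tq.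
  exists i; first by rewrite leqnn leq_addr.
  have [[t /=]] := tq; rewrite in_itv/= => /andP[t0 tl] <- _.
  have L0 : 0 <= L by exact: le_trans (mdist_ge0 _ _) (fL 0).
  rewrite mul0r add0r metric_sym (geodesic_distl gg)//.
  have := path_lipschitz i N; move: Nr; rewrite expn0.
  case: N {gg tq} tl => [|[|//]] tl _; rewrite ?mulr0 ?mulr1; lra.
set N1 := N./2; set N2 := (N - N1)%N.
have NE : (i + N = i + N1 + N2)%N by rewrite /N1 /N2; lia.
have [N1r N2r] : (N1 <= 2 ^ r /\ N2 <= 2 ^ r)%N.
  by move: Nr; rewrite /N2 /N1 expnS; split; lia.
have [g1 gg1] := geoX (f i) (f (i + N1)%N).
have [g2 gg2] := geoX (f (i + N1)%N) (f (i + N)%N).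
have [q' [tq'|tq'] qq'] := thin _ _ _ _ _ _ gg gg1 gg2 _ tq.
- have [j /andP[ij jN] jq] := IH _ _ _ _ N1r gg1 tq'.
  exists j; first by apply/andP; split; lia.
  have := metric_triangle q q' (f j); rewrite -natr1 mulrDl; lra.
- rewrite NE in gg2 tq'.
  have [j /andP[ij jN] jq] := IH _ _ _ _ N2r gg2 tq'.
  exists j; first by apply/andP; split; lia.
  have := metric_triangle q q' (f j); rewrite -natr1 mulrDl; lra.
Qed.

(* Walking along the geodesic, the index of a nearby point of the path jumps
   over i somewhere; the path then makes a detour around f i with endpoints
   close to each other, which is short by the assumed progress. *)
Lemma path_near_geodesic n g r W i : 0 <= L -> 0 <= r ->
  geodesic (f 0) (f n) g ->
  (forall t, 0 <= t <= mdist (f 0) (f n) ->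
    exists2 j, (j <= n)%N & mdist (g t) (f j) <= r) ->
  (forall j k, (j <= k <= n)%N -> mdist (f j) (f k) <= 2 * r + 1 ->
    (k - j)%:R <= W) ->
  (i <= n)%N ->
  exists2 t, 0 <= t <= mdist (f 0) (f n) & mdist (g t) (f i) <= r + L * W.
Proof.
move=> L0 r0 gg near prog lein; have T0 := mdist_ge0 (f 0) (f n).
set T := mdist (f 0) (f n) in near T0 *.
(* Integer sample points, truncated at [T] so that the endpoint of the geodesic is among them. *)
pose pt (k : nat) := Num.min k%:R T.
have ptP k : 0 <= pt k <= T by rewrite le_min ler0n T0 ge_min lexx orbT.
pose P k := `[< exists j, (i <= j <= n)%N /\ mdist (g (pt k)) (f j) <= r >].
have exP : exists k, P k.
  exists (Num.truncn T).+1; apply/asboolP; exists n; split; first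
    by rewrite lein leqnn.
  have -> : pt (Num.truncn T).+1 = T by apply: min_r; exact/ltW/truncnS_gt.
  by have [_ -> _] := gg; rewrite mdistxx.
(* By minimality the preceding sample point is only near indices below [i]; it is at most one unit
   away, which accounts for the [r + 1] below. *)
case: (ex_minnP exP) => k /asboolP[j2 [/andP[ij2 j2n] kj2]] kmin.
have [j1 j1i j1k] : exists2 j1, (j1 <= i)%N & mdist (g (pt k)) (f j1) <= r + 1.
  case: k kj2 kmin => [|k] kj2 kmin.
    exists 0%N => //; rewrite /pt min_l//; have [-> _ _] := gg.
    by rewrite mdistxx; lra.
  have [j jn jk] := near _ (ptP k).
  exists j.
    rewrite leqNgt; apply/negP => lij.
    have /kmin : P k by apply/asboolP; exists j; rewrite (ltnW lij).
    by rewrite ltnn.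
  have := metric_triangle (g (pt k.+1)) (g (pt k)) (f j).
  have /andP[pk0 pkT] := ptP k; have /andP[pk0' pkT'] := ptP k.+1.
  have [pkS pkS1] : pt k <= pt k.+1 /\ pt k.+1 <= pt k + 1.
    rewrite /pt -natr1; split.
      by rewrite le_min !ge_min lexx orbT andbT lerDl ler01.
    by rewrite addr_minl le_min !ge_min lexx/= orbC lerDl ler01.
  rewrite metric_sym [mdist (g (pt k.+1)) (g (pt k))]metric_sym.
  by rewrite (geodesic_dist gg pk0 pkS pkT') (metric_sym (f j)); lra.
have j12 : mdist (f j1) (f j2) <= 2 * r + 1.
  have := metric_triangle (f j1) (g (pt k)) (f j2).
  by rewrite (metric_sym (f j1) (g _)); lra.
have := prog j1 j2; rewrite (leq_trans j1i ij2) j2n => /(_ isT j12) W12.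
exists (pt k) => //.
have := path_lipschitz i (j2 - i); rewrite subnKC// => ij.
have := metric_triangle (g (pt k)) (f j2) (f i).
rewrite (metric_sym (f j2)).
have : L * (j2 - i)%:R <= L * W.
  apply: ler_wpM2l => //; apply: le_trans W12.
  by rewrite ler_nat leq_sub2l.
lra.
Qed.

End Paths.

Lemma dHaus_le (R : realType) (X : metricType R) (A B : set X) (r r' : R) :
  0 <= r -> r < r' ->
  (forall x, A x -> exists2 y, B y & mdist x y <= r) ->
  (forall y, B y -> exists2 x, A x & mdist y x <= r) ->
  (dHaus A B <= r'%:E)%E.
Proof.
move=> r0 rr' AB BA; apply: ereal_inf_lbound; exists r' => //; split; first lra.
- by move=> x /AB[y By xy]; exists y => //; lra.
- by move=> y /BA[x Ax yx]; exists x => //; lra.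
Qed.

(** * Random words *)

Section Words.
Context (R : realType) (G : groupType) (S : seq G) (mu : G -> R).
Implicit Types (f : seq G -> R) (A B : seq G -> Prop) (m n : nat) (l u v : seq G).

Fixpoint words n : seq (seq G) :=
  if n is n'.+1 then [seq g :: l | g <- S, l <- words n'] else [:: [::]].

Definition weight l : R := \prod_(g <- l) mu g.

(** Expectations are finite sums over words, so conditioning on an initial segment amounts to
    splitting the word ([Ew_cat]). *)
Definition Ew n f : R := \sum_(l <- words n) weight l * f l.

Definition Pw n A : R := Ew n (fun l => `[< A l >]%:R).

Lemma mem_words n l : l \in words n -> size l = n /\ {subset l <= S}.
Proof.
elim: n l => [|n IH] l /=; first by rewrite inE => /eqP ->.
move=> /allpairsP[[g l'] /= [gS /IH[<- l'S] ->]]; split => //.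
by move=> h; rewrite inE => /predU1P[->|/l'S].
Qed.

Lemma words_mem l : {subset l <= S} -> l \in words (size l).
Proof.
elim: l => [|g l IH] lS //=.
apply/allpairsP; exists (g, l); split => //=; first by apply: lS; rewrite mem_head.
by apply: IH => h hl; apply: lS; rewrite inE hl orbT.
Qed.

Lemma Ew0 f : Ew 0 f = f [::].
Proof. by rewrite /Ew big_seq1 /weight big_nil mul1r. Qed.

Lemma EwS n f : Ew n.+1 f = \sum_(g <- S) mu g * Ew n (fun l => f (g :: l)).
Proof.
rewrite /Ew /= big_allpairs_dep/=; apply: eq_bigr => g _.
rewrite big_distrr/=; apply: eq_bigr => l _.
by rewrite /weight big_cons mulrA.
Qed.

Lemma eq_Ew n f f' : {in words n, f =1 f'} -> Ew n f = Ew n f'.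
Proof. by move=> ff'; apply: eq_big_seq => l /ff' ->. Qed.

Lemma Ew_cat m n f : Ew (m + n) f = Ew m (fun u => Ew n (fun v => f (u ++ v))).
Proof.
elim: m f => [|m IH] f; first by rewrite add0n Ew0.
by rewrite addSn !EwS; apply: eq_bigr => g _; rewrite IH.
Qed.

Lemma EwSr n f : Ew n.+1 f = Ew n (fun l => \sum_(g <- S) mu g * f (rcons l g)).
Proof.
rewrite -addn1 Ew_cat; apply: eq_Ew => l _; rewrite EwS.
by apply: eq_bigr => g _; rewrite Ew0 cats1.
Qed.

Lemma Ew_sum n (I : Type) (r : seq I) (F : I -> seq G -> R) :
  Ew n (fun l => \sum_(i <- r) F i l) = \sum_(i <- r) Ew n (F i).
Proof.
rewrite /Ew exchange_big/=; apply: eq_bigr => l _.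
by rewrite big_distrr.
Qed.

Lemma EwZ n (a : R) f : Ew n (fun l => a * f l) = a * Ew n f.
Proof.
by rewrite /Ew big_distrr/=; apply: eq_bigr => l _; rewrite mulrCA.
Qed.

Lemma exchange_Ew m n (F : seq G -> seq G -> R) :
  Ew m (fun u => Ew n (F u)) = Ew n (fun v => Ew m (F^~ v)).
Proof.
rewrite /Ew; under eq_bigr do rewrite big_distrr/=.
rewrite exchange_big/=; apply: eq_bigr => v _; rewrite big_distrr/=.
by apply: eq_bigr => u _; rewrite mulrCA.
Qed.

Hypothesis mu_ge0 : forall g, 0 <= mu g.
Hypothesis mu_sum : \sum_(g <- S) mu g = 1.

Lemma weight_ge0 l : 0 <= weight l.
Proof. exact: prodr_ge0. Qed.

Lemma Ew_le n f f' : {in words n, forall l, f l <= f' l} -> Ew n f <= Ew n f'.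
Proof.
move=> ff'; rewrite /Ew !big_seq; apply: ler_sum => l /ff' ?.
by rewrite ler_wpM2l// weight_ge0.
Qed.

Lemma Ew_cst n (a : R) : Ew n (fun=> a) = a.
Proof.
elim: n => [|n IH]; first by rewrite Ew0.
by rewrite EwS IH -big_distrl/= mu_sum mul1r.
Qed.

Lemma Pw_ge0 n A : 0 <= Pw n A.
Proof. by rewrite -[leLHS](Ew_cst n); apply: Ew_le. Qed.

Lemma Pw_le1 n A : Pw n A <= 1.
Proof.
by rewrite -[leRHS](Ew_cst n); apply: Ew_le => l _; case: `[< _ >]; rewrite ?ler01.
Qed.

Lemma Pw_sub n A B : {in words n, forall l, A l -> B l} -> Pw n A <= Pw n B.
Proof.
move=> AB; apply: Ew_le => l ln.
have [Al|] := asboolP (A l); last by rewrite ler0n.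
by rewrite asboolT//; exact: AB.
Qed.

Lemma Pw_not n A : Pw n A + Pw n (fun l => ~ A l) = 1.
Proof.
rewrite /Pw /Ew -big_split/= -[RHS](Ew_cst n); apply: eq_bigr => l _.
rewrite -mulrDr; congr (_ * _).
have [Al|nAl] := asboolP (A l).
  by rewrite (asboolF (P := ~ A l)) ?addr0//; apply/contrapT.
by rewrite (asboolT (P := ~ A l)) ?add0r.
Qed.

Lemma Pw_cat m n A : Pw (m + n) A = Ew m (fun u => Pw n (fun v => A (u ++ v))).
Proof. exact: Ew_cat. Qed.

Lemma Pw_take m n A : (m <= n)%N -> Pw n (fun l => A (take m l)) = Pw m A.
Proof.
move=> mn; rewrite -(subnKC mn) Pw_cat; apply: eq_Ew => u /mem_words[um _].
rewrite /Pw -[RHS](Ew_cst (n - m)); apply: eq_Ew => v _.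
by rewrite -um take_size_cat.
Qed.

Lemma Pw_drop m n A : (m <= n)%N -> Pw n (fun l => A (drop m l)) = Pw (n - m) A.
Proof.
move=> mn; rewrite -{1}(subnKC mn) Pw_cat -[RHS](Ew_cst m).
apply: eq_Ew => u /mem_words[um _]; apply: eq_Ew => v _.
by rewrite -um drop_size_cat.
Qed.

Lemma Pw_exists n (I : eqType) (r : seq I) (A : I -> seq G -> Prop) :
  Pw n (fun l => exists2 i, i \in r & A i l) <= \sum_(i <- r) Pw n (A i).
Proof.
rewrite -Ew_sum; apply: Ew_le => l _.
have [[i ir Ai]|_] := asboolP (exists2 i, i \in r & A i l).
  by rewrite (big_rem i ir)/= asboolT// lerDl sumr_ge0.
by apply: sumr_ge0.
Qed.

End Words.

(** * The law of the first increments of the walk *)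

Definition steps (G : groupType) (Omega : Type) (s : nat -> Omega -> G) n w :
  seq G := [seq s i w | i <- iota 0 n].

Section IndependentSteps.
Context (R : realType) (G : groupType) (S : seq G) (mu : G -> R).
Context (d : measure_display) (Omega : measurableType d).
Context (Pr : probability Omega R) (s : nat -> Omega -> G).
Hypothesis mu_ge0 : forall g, 0 <= mu g.
Hypothesis mu_sum : \sum_(g <- S) mu g = 1.
Hypothesis S_uniq : uniq S.
Hypothesis Gcountable : countable [set: G].
Hypothesis iid : iid_with_law Pr mu s.

Let ms i (B : set G) : measurable (s i @^-1` B).
Proof. by case: iid. Qed.

Lemma steps_eq l : [set w | steps s (size l) w = l] =
  \big[setI/setT]_(i <- iota 0 (size l)) (s i @^-1` [set nth 1%g l i]).
Proof.
rewrite /steps -bigcap_seq; apply/seteqP; split => w /=.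
  move=> wl i /=; rewrite mem_iota add0n => /andP[_ il].
  by rewrite -wl (nth_map 0%N) ?size_iota ?nth_iota.
move=> wl; apply: (@eq_from_nth _ 1%g); first by rewrite size_map size_iota.
move=> i; rewrite size_map size_iota => il.
rewrite (nth_map 0%N) ?size_iota// nth_iota// add0n; apply: wl.
by rewrite /= mem_iota.
Qed.

Lemma measurable_steps_eq n l : measurable [set w | steps s n w = l].
Proof.
have [<-|nl] := eqVneq (size l) n.
  by rewrite steps_eq; apply: bigsetI_measurable.
rewrite (_ : [set _ | _] = set0)//; apply/seteqP; split => // w /= wl.
by move: nl; rewrite -wl size_map size_iota eqxx.
Qed.

Lemma Pr_steps_eq l : Pr [set w | steps s (size l) w = l] = (weight mu l)%:E.
Proof.
have [_ law indep] := iid.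
rewrite steps_eq (indep _ (fun i => [set nth 1%g l i])) ?iota_uniq//.
rewrite (eq_bigr (fun i => (mu (nth 1%g l i))%:E)) => [|i _]; last exact: law.
by rewrite prodEFin /weight (big_nth 1%g) /index_iota subn0.
Qed.

Lemma measurable_steps n (A : seq G -> Prop) : measurable [set w | A (steps s n w)].
Proof.
rewrite (_ : [set _ | _] = \bigcup_l ([set w | steps s n w = l] `&` [set _ | A l])).
  apply: countable_bigcupT_measurable.
    have /countable_injP[f finj] := Gcountable.
    apply/countable_injP;
      exists (pickle \o map f) => l l' _ _ /= /(pcan_inj pickleK).
    by apply: inj_map => g h fgh; apply: finj; rewrite ?inE.
  move=> l; apply: measurableI; first exact: measurable_steps_eq.
  have [Al|nAl] := pselect (A l).
    by rewrite (_ : [set _ | _] = setT)//; apply/seteqP; split.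
  by rewrite (_ : [set _ | _] = set0)//; apply/seteqP; split.
apply/seteqP; split => w /=; first by move=> Aw; exists (steps s n w).
by move=> [l _ [-> ]].
Qed.

Let Pr_seq_le (I : Type) (r : seq I) (F : I -> set Omega) :
  (forall i, measurable (F i)) ->
  (Pr (\big[setU/set0]_(i <- r) F i) <= \sum_(i <- r) Pr (F i))%E.
Proof.
move=> mF; elim: r => [|i r IH]; first by rewrite !big_nil measure0.
rewrite !big_cons; apply: le_trans (leeD2l _ IH).
by apply: measureU2 => //; exact: bigsetU_measurable.
Qed.

Let Pr_notin i : Pr (s i @^-1` [set g | g \notin S]) = 0%E.
Proof.
have [_ law _] := iid.
have PrS (r : seq G) : uniq r ->
    Pr (s i @^-1` [set` r]) = (\sum_(g <- r) mu g)%:E.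
  elim: r => [_|g r IH /= /andP[gr ur]].
    rewrite big_nil (_ : _ @^-1` _ = set0) ?measure0//.
    by apply/seteqP; split.
  rewrite big_cons EFinD -IH// -(law i) -measureU//.
    congr (Pr _); apply/seteqP; split => w /=; rewrite inE.
      by move=> /predU1P[|]; [left|right].
    by move=> [->|->]; rewrite ?eqxx ?orbT.
  by apply/seteqP; split => // w /= [->]; rewrite (negbTE gr).
rewrite (_ : _ @^-1` _ = ~` (s i @^-1` [set` S])).
  rewrite probability_setC; last exact: ms.
  by rewrite PrS// mu_sum -EFinB subrr.
by apply/seteqP; split => w /= /negP.
Qed.

(** The event is covered by finitely many cylinders of words over [S] and by the null events that
    some increment lies outside [S]. *)
Let Pr_steps_le n (A : seq G -> Prop) :
  (Pr [set w | A (steps s n w)] <= (Pw S mu n A)%:E)%E.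
Proof.
pose W := [seq l <- words S n | `[< A l >]].
pose U1 := \big[setU/set0]_(l <- W) [set w | steps s n w = l].
pose U2 := \big[setU/set0]_(i <- iota 0 n) (s i @^-1` [set g | g \notin S]).
have mU1 : measurable U1.
  by apply: bigsetU_measurable => l _; exact: measurable_steps_eq.
have mU2 : measurable U2 by apply: bigsetU_measurable => i _; exact: ms.
have sub : [set w | A (steps s n w)] `<=` U1 `|` U2.
  move=> w /= Aw; have [/allP wS|] := boolP (all (mem S) (steps s n w)).
    left; rewrite /U1 -bigcup_seq; exists (steps s n w) => //=.
    rewrite mem_filter asboolT//=.
    by have := words_mem wS; rewrite size_map size_iota.
  move=> /allPn[g /mapP[i iin ->]] iS; right.
  by rewrite /U2 -bigcup_seq; exists i.
apply: (le_trans (le_measure Pr _ _ sub)); rewrite ?inE//.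
- exact: measurable_steps.
- exact: measurableU.
apply: (le_trans (measureU2 Pr mU1 mU2)).
rewrite -[leRHS]adde0; apply: leeD.
  apply: (le_trans (Pr_seq_le _ _)) => [l|]; first exact: measurable_steps_eq.
  rewrite /Pw /Ew -sumEFin /W big_filter big_mkcond/= !big_seq.
  apply: lee_sum => l /mem_words[ln _].
  case: asboolP => _; last by rewrite mulr0.
  by rewrite mulr1 -ln Pr_steps_eq.
apply: (le_trans (Pr_seq_le _ _)) => [i|]; first exact: ms.
by rewrite big1// => i _; exact: Pr_notin.
Qed.

(** The upper bound for [A] and for its complement together force equality. *)
Lemma Pr_steps n (A : seq G -> Prop) :
  Pr [set w | A (steps s n w)] = (Pw S mu n A)%:E.
Proof.
apply/eqP; rewrite eq_le Pr_steps_le/=.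
have := Pr_steps_le n (fun l => ~ A l).
rewrite (_ : [set w | ~ _] = ~` [set w | A (steps s n w)])//.
rewrite probability_setC; last exact: measurable_steps.
have mA := @measurable_steps n A.
rewrite -(fineK (fin_num_measure Pr _ mA)) -EFinB !lee_fin.
by have := Pw_not mu_sum n A; lra.
Qed.

End IndependentSteps.

Definition wprod (G : groupType) (l : seq G) : G := (\prod_(g <- l) g)%g.

Section WordProducts.
Context (G : groupType).
Implicit Types (u v : seq G) (g : G).

Lemma wprod_nil : wprod [::] = 1%g :> G.
Proof. exact: big_nil. Qed.

Lemma wprod_cons g u : wprod (g :: u) = (g * wprod u)%g.
Proof. exact: big_cons. Qed.

Lemma wprod_cat u v : wprod (u ++ v) = (wprod u * wprod v)%g.
Proof. exact: big_cat. Qed.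

Lemma wprod_rcons u g : wprod (rcons u g) = (wprod u * g)%g.
Proof. by rewrite -cats1 wprod_cat /wprod big_seq1. Qed.

End WordProducts.

Lemma seq_lower_bound (R : realType) (T : eqType) (r : seq T) (f : T -> R) :
  (forall x, x \in r -> 0 < f x) ->
  exists2 e, 0 < e <= 1 & forall x, x \in r -> e <= f x.
Proof.
elim: r => [|x r IH] fpos; first by exists 1; rewrite ?ltr01 ?lexx.
have [|e /andP[e0 e1] er] := IH; first by move=> y yr; apply: fpos;
  rewrite inE yr orbT.
exists (Num.min e (f x)).
  by rewrite lt_min e0 fpos ?mem_head//= ge_min e1.
move=> y; rewrite inE => /predU1P[->|/er]; first by rewrite ge_min lexx orbT.
by rewrite ge_min => ->.
Qed.

(** * Time spent by the walk at a single point of an orbit *)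

Section Occupation.
Context (R : realType) (G : groupType) (S : seq G) (mu : G -> R).
Context (Y : Type) (D : set Y) (a : G -> Y -> Y).
Hypothesis mu_sum : \sum_(g <- S) mu g = 1.
Hypothesis mu_ge0 : forall g, 0 <= mu g.
Hypothesis mu_gt0 : forall g, g \in S -> 0 < mu g.
Hypothesis a1 : forall y, a 1%g y = y.
Hypothesis aM : forall g h y, a (g * h)%g y = a g (a h y).
Hypothesis aD : forall g y, D y -> D (a g y).
Hypothesis three : forall y, D y -> exists g h z,
  [/\ g \in S, h \in S, z = a h y \/ z = a h (a g y) &
      [/\ y <> a g y, y <> z & a g y <> z]].

Let hit (P y : Y) j := Pw S mu j (fun u => a (wprod u) y = P).

Definition occupation m (P y : Y) : R := m%:R^-1 * \sum_(0 <= j < m) hit P y j.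

Let a_inj g : injective (a g).
Proof.
by move=> y z ayz; rewrite -[y]a1 -[z]a1 -(mulVg g) !aM ayz.
Qed.

(** The last letter of a word is the first to act on [y], so the conditioning is on the last
    letter. *)
Let hitS P y j : hit P y j.+1 = \sum_(g <- S) mu g * hit P (a g y) j.
Proof.
rewrite /hit /Pw EwSr Ew_sum; apply: eq_bigr => g _.
rewrite EwZ; congr (_ * _); apply: eq_Ew => l _.
by rewrite wprod_rcons aM.
Qed.

(** Averaging over one step shifts the time window by one, which only trades the term at time 0 for
    the one at time [m]; both are probabilities. *)
Let occupation_mean m P y : (0 < m)%N ->
  occupation m P y - m%:R^-1 <= \sum_(g <- S) mu g * occupation m P (a g y).
Proof.
move=> m0.
have -> : \sum_(g <- S) mu g * occupation m P (a g y) =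
    m%:R^-1 * \sum_(0 <= j < m) hit P y j.+1.
  under [in RHS]eq_bigr do rewrite hitS.
  rewrite exchange_big/= big_distrr/=; apply: eq_bigr => g _.
  by rewrite -big_distrr/= mulrCA.
rewrite /occupation -{2}[m%:R^-1]mulr1 -mulrBr ler_pM2l ?invr_gt0 ?ltr0n//.
have : hit P y 0 + \sum_(0 <= j < m) hit P y j.+1 =
    \sum_(0 <= j < m) hit P y j + hit P y m.
  by rewrite -big_nat_recl// big_nat_recr.
have := Pw_ge0 mu_ge0 mu_sum m (fun u => a (wprod u) y = P).
have := Pw_le1 mu_ge0 mu_sum 0 (fun u => a (wprod u) y = P).
rewrite -/(hit P y m) -/(hit P y 0); lra.
Qed.

Let occupation_le1 m P y : (0 < m)%N -> occupation m P y <= 1.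
Proof.
move=> m0; rewrite /occupation ler_pdivrMl ?ltr0n// mulr1.
apply: (@le_trans _ _ (\sum_(0 <= j < m) 1)).
  by apply: ler_sum => j _; apply: Pw_le1.
by rewrite sumr_const_nat subn0.
Qed.

(** Group elements act injectively, so a word carries at most one of the three points to [P]. *)
Let occupation3 m P x y z : (0 < m)%N -> x <> y -> x <> z -> y <> z ->
  occupation m P x + occupation m P y + occupation m P z <= 1.
Proof.
move=> m0 xy xz yz; rewrite /occupation -!mulrDr -!big_split/=.
rewrite ler_pdivrMl ?ltr0n// mulr1.
apply: (@le_trans _ _ (\sum_(0 <= j < m) 1)); last by rewrite sumr_const_nat subn0.
apply: ler_sum => j _.
rewrite /hit /Pw /Ew -!big_split/= -[leRHS](Ew_cst mu_sum j).
rewrite /Ew; apply: ler_sum => l _; rewrite -!mulrDr ler_wpM2l//.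
  exact: weight_ge0.
case: asboolP => Px; case: asboolP => Py; case: asboolP => Pz;
  rewrite ?addr0 ?add0r ?ler01 ?lexx//; exfalso.
- by apply: xy; apply: (@a_inj (wprod l)); rewrite Px Py.
- by apply: xy; apply: (@a_inj (wprod l)); rewrite Px Py.
- by apply: xz; apply: (@a_inj (wprod l)); rewrite Px Pz.
- by apply: yz; apply: (@a_inj (wprod l)); rewrite Py Pz.
Qed.

(* The occupation density is almost harmonic, so it is almost maximal at all
   neighbours of an almost maximal point; hence three distinct points share its
   maximum. *)
Lemma occupation_small : exists2 m, (0 < m)%N &
  forall P y, D y -> occupation m P y <= 2 / 5.
Proof.
have [e /andP[e0 e1] eS] := seq_lower_bound mu_gt0.
(* The three almost maximal values fall short of [M] by at most [6 * (eta / e ^+ 2)] in total, so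
   [M] is at most [1 / 3 + 2 / 45], which is below [2 / 5]. *)
pose m := (Num.truncn (45 / e ^+ 2)).+1.
have m0 : (0 < m)%N by [].
exists m => // P y Dy.
set eta := (m%:R : R)^-1.
have eta0 : 0 < eta by rewrite invr_gt0 ltr0n.
have etae : eta / e ^+ 2 <= 1 / 45.
  rewrite ler_pdivrMr ?exprn_gt0// mulrC mulrA mulr1.
  rewrite ler_pdivlMr// /eta ler_pdivrMl ?ltr0n// -ler_pdivrMr ?exprn_gt0//.
  exact/ltW/truncnS_gt.
pose E := [set occupation m P z | z in D].
have Eub : has_ubound E.
  by exists 1 => _ [z _ <-]; exact: occupation_le1.
have supE : has_sup E by split => //; exists (occupation m P y), y.
set M := sup E.
have leM z : D z -> occupation m P z <= M.
  by move=> Dz; apply: ub_le_sup => //; exists z.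
(* No term of the average exceeds [M] and the one at [g] has weight at least [e], so it absorbs a
   deficit of at most [(b + eta) / e]. *)
have next z g b : D z -> g \in S -> M - b <= occupation m P z ->
    M - (b + eta) / e <= occupation m P (a g z).
  move=> Dz gS bz.
  have := occupation_mean P z m0; rewrite (big_rem g gS)/= => le1.
  have le2 : \sum_(h <- rem g S) mu h * occupation m P (a h z) <= (1 - mu g) * M.
    have -> : 1 - mu g = \sum_(h <- rem g S) mu h.
      by have := mu_sum; rewrite (big_rem g gS)/=; lra.
    rewrite big_distrl/=; apply: ler_sum => h _.
    by rewrite ler_wpM2l//; apply/leM/aD.
  have gM := leM _ (aD g Dz).
  suff : M - occupation m P (a g z) <= (b + eta) / e by lra.
  rewrite ler_pdivlMr//.
  have : (M - occupation m P (a g z)) * e <= (M - occupation m P (a g z)) * mu g.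
    by rewrite ler_wpM2l ?subr_ge0// eS.
  by move: le1; rewrite -/eta; lra.
have [_ [y0 Dy0 <-] y0M] := sup_adherent eta0 supE.
have [g [h [z [gS hS zE [y01 y02 y12]]]]] := three Dy0.
have y0M' : M - eta <= occupation m P y0 by exact: ltW.
have y1M := next _ _ _ Dy0 gS y0M'.
have [ei1 ei2] : 1 <= e^-1 /\ e^-1 <= e^-1 ^+ 2.
  have : 1 <= e^-1 by rewrite invf_ge1.
  by split => //; rewrite expr2 ler_peMl// invr_ge0 ltW.
have b1 : eta <= eta / e by rewrite ler_peMr// ltW.
have b2 : eta / e <= eta / e ^+ 2.
  by rewrite -exprVn ler_wpM2l// ltW.
have b3 : (eta + eta) / e = eta / e + eta / e by rewrite mulrDl.
have b4 : eta / e / e = eta / e ^+ 2 by rewrite -mulrA -invfM -expr2.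
have zM : M - 3 * (eta / e ^+ 2) <= occupation m P z.
  case: zE => ->.
  - by have := next _ _ _ Dy0 hS y0M'; lra.
  - have := next _ _ _ (aD g Dy0) hS y1M.
    by rewrite b3 mulrDl mulrDl b4; lra.
have := occupation3 P m0 y01 y02 y12.
by have := leM _ Dy; move: zM etae; set o := eta / e ^+ 2 in b2 *; lra.
Qed.

End Occupation.

(** * Tails of projections *)

Section Equivariance.
Context (R : realType) (X : metricType R) (PP : set (set X)).
Context (proj : set X -> X -> X) (nu rho c : R).
Hypothesis ps : projection_system PP proj nu rho c.
Context (G : groupType) (act : G -> X -> X).
Hypothesis act_isom : isometric_action act.
Hypothesis act_PP : forall g P, PP P -> PP (act g @` P).
Implicit Types (P Q : set X) (x y : X) (g h : G).

Lemma mdist_act g x y : mdist (act g x) (act g y) = mdist x y.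
Proof. by case: act_isom. Qed.

Lemma actM g h x : act (g * h)%g x = act g (act h x).
Proof. by case: act_isom. Qed.

Lemma actVK g : cancel (act g^-1%g) (act g).
Proof. by move=> x; rewrite -actM mulgV; case: act_isom. Qed.

Lemma act_image1 P : act 1%g @` P = P.
Proof.
have [act1 _ _] := act_isom.
by rewrite (_ : act 1%g = id) ?image_id//; apply/funext.
Qed.

Lemma act_imageM g h P : act (g * h)%g @` P = act g @` (act h @` P).
Proof. by rewrite image_comp; congr (_ @` _); apply/funext => x; exact: actM. Qed.

Lemma act_imageK g P : act g^-1%g @` (act g @` P) = P.
Proof. by rewrite -act_imageM mulVg act_image1. Qed.

Lemma act_imageVK g P : act g @` (act g^-1%g @` P) = P.
Proof. by rewrite -act_imageM mulgV act_image1. Qed.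

(** An isometry carries an almost closest point to an almost closest point, and these are coarsely
    unique. *)
Lemma act_proj P x g : PP P ->
  mdist (act g (proj P x)) (proj (act g @` P) (act g x)) <= 2 * c + 1.
Proof.
move=> PPP; apply: (proj_unique ps) => //; first exact: act_PP.
  by exists (proj P x) => //; exact: (ps_mem ps).
by move=> _ [z Pz <-]; rewrite !mdist_act; exact: (ps_min ps).
Qed.

Definition pdist P x y : R := mdist (proj P x) (proj P y).

Lemma pdist_triangle P x y z : pdist P x z <= pdist P x y + pdist P y z.
Proof. exact: metric_triangle. Qed.

Lemma pdistC P x y : pdist P x y = pdist P y x.
Proof. exact: metric_sym. Qed.

Lemma pdist_act P x y g : PP P ->
  pdist (act g @` P) (act g x) (act g y) <= pdist P x y + (4 * c + 2).
Proof.
move=> PPP; rewrite /pdist.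
have := act_proj x g PPP; have := act_proj y g PPP.
set P' := act g @` P.
have := metric_triangle (proj P' (act g x)) (act g (proj P x)) (proj P' (act g y)).
have := metric_triangle (act g (proj P x)) (act g (proj P y)) (proj P' (act g y)).
by rewrite mdist_act (metric_sym (proj P' (act g x)) (act g _)); lra.
Qed.

Lemma pdist_shift P x g h : PP P ->
  pdist P (act g x) (act (g * h)%g x) <=
  pdist (act g^-1%g @` P) x (act h x) + (4 * c + 2).
Proof.
move=> PPP; have := pdist_act x (act h x) g (act_PP g^-1%g PPP).
by rewrite act_imageVK -actM.
Qed.

Lemma mdistV g x : mdist x (act g^-1%g x) = mdist x (act g x).
Proof. by rewrite -(mdist_act g) actVK metric_sym. Qed.

Let proj_act_dist_le P x g : PP P ->
  mdist x (proj (act g @` P) x) <= mdist x (act g x) + mdist x (proj P x) + 1.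
Proof.
move=> PPP.
have : (act g @` P) (act g (proj P x)) by exists (proj P x) => //;
  exact: (ps_mem ps).
move=> /(ps_min ps x (act_PP g PPP)).
have := metric_triangle x (act g x) (act g (proj P x)).
by rewrite mdist_act; lra.
Qed.

Lemma proj_act_dist P x g : PP P ->
  `|mdist x (proj (act g @` P) x) - mdist x (proj P x)| <= mdist x (act g x) + 1.
Proof.
move=> PPP; have := proj_act_dist_le x g PPP.
have := proj_act_dist_le x g^-1%g (act_PP g PPP).
rewrite act_imageK mdistV ler_norml => ? ?.
by apply/andP; split; lra.
Qed.

End Equivariance.

Section ProjectionTail.
Context (R : realType) (X : metricType R) (PP : set (set X)).
Context (proj : set X -> X -> X) (nu rho c : R).
Hypothesis ps : projection_system PP proj nu rho c.
Context (G : groupType) (act : G -> X -> X).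
Hypothesis act_isom : isometric_action act.
Hypothesis act_PP : forall g P, PP P -> PP (act g @` P).
Context (S : seq G) (mu : G -> R).
Hypothesis mu_sum : \sum_(g <- S) mu g = 1.
Hypothesis mu_ge0 : forall g, 0 <= mu g.
Hypothesis mu_gt0 : forall g, g \in S -> 0 < mu g.
Context (p : X) (L : R).
Hypothesis L0 : 0 <= L.
Hypothesis step_le : forall g, g \in S -> mdist p (act g p) <= L.
Implicit Types (P Q : set X) (g h : G) (u v l : seq G).

Let E : R := 4 * c + 2.
Let E0 : 0 <= E.
Proof. by have := ps_ge0 ps; rewrite /E; lra. Qed.

Lemma word_displacement l : {subset l <= S} ->
  mdist p (act (wprod l) p) <= L * (size l)%:R.
Proof.
elim: l => [_|g l IH lS].
  by rewrite wprod_nil mulr0; have [-> _ _] := act_isom; rewrite mdistxx.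
rewrite wprod_cons (actM act_isom)/= -natr1 mulrDr mulr1.
have := metric_triangle p (act g p) (act g (act (wprod l) p)).
rewrite (mdist_act act_isom).
have gL : mdist p (act g p) <= L by apply/step_le/lS; rewrite mem_head.
have : mdist p (act (wprod l) p) <= L * (size l)%:R.
  by apply: IH => h hl; apply: lS; rewrite inE hl orbT.
lra.
Qed.

Let f P g := pdist proj P p (act g p).

Let f1 P : f P 1%g = 0.
Proof. by rewrite /f /pdist; have [-> _ _] := act_isom; exact: mdistxx. Qed.

Let f_triangle P g h : f P h <= f P g + pdist proj P (act g p) (act h p).
Proof. exact: pdist_triangle. Qed.

Let f_triangler P g h : f P g <= f P h + pdist proj P (act g p) (act h p).
Proof. by rewrite (pdistC _ _ (act g p)); exact: pdist_triangle. Qed.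

Let fM P g h : PP P -> f P (g * h)%g <= f P g + f (act g^-1%g @` P) h + E.
Proof.
move=> PPP; have := pdist_shift ps act_isom act_PP p g h PPP.
have := pdist_triangle proj P p (act g p) (act (g * h)%g p).
by rewrite /f /E; lra.
Qed.

Let f_lip P g l : PP P -> {subset l <= S} ->
  pdist proj P (act g p) (act (g * wprod l)%g p) <= L * (size l)%:R + c.
Proof.
move=> PPP lS; have := proj_lipschitz ps (act g p) (act (g * wprod l)%g p) PPP.
rewrite (actM act_isom) (mdist_act act_isom) => le1.
by have := word_displacement lS; rewrite /pdist; lra.
Qed.

Hypothesis three : forall P, PP P -> exists g h Q,
  [/\ g \in S, h \in S, Q = act h @` P \/ Q = act h @` (act g @` P) &
      [/\ P <> act g @` P, P <> Q & act g @` P <> Q]].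

(** Translates of [P] by inverses of words shorter than [m] have comparable distances to [p], so at
    most one translate sees a large projection of a given word [v]; [occupation_small] bounds the
    time spent there. *)
Lemma projection_tight : exists2 K : R, 0 <= K & forall P n, PP P ->
  Pw S mu n (fun l => K < f P (wprod l)) <= 2 / 5.
Proof.
have c0 := ps_ge0 ps.
have [m m0 occ] := occupation_small mu_sum mu_ge0 mu_gt0
  (act_image1 act_isom) (act_imageM act_isom) act_PP three.
have [m' m'E] : {x : R | x = m%:R} by exists m%:R.
have m'0 : 0 < m' by rewrite m'E ltr0n.
have Lm0 : 0 <= L * m' by rewrite mulr_ge0// ltW.
(* Distances from [p] to two such translates differ by at most [2 * (L * m' + 1)], so [K1] is the
   threshold of [proj_exclusive]. The excess of [K] pays for adding letters at the end, removing a
   prefix, and equivariance. *)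
pose K1 := 2 * (L * m' + 1) + 3 * c.
pose K := K1 + 2 * (L * m' + c) + E.
have word_le j u : (j < m)%N -> u \in words S j ->
    [/\ {subset u <= S}, L * (size u)%:R <= L * m' &
        mdist p (act (wprod u) p) <= L * m'].
  move=> jm /mem_words[uj uS].
  have le1 : L * (size u)%:R <= L * m' by rewrite ler_wpM2l// m'E ler_nat uj ltnW.
  by split => //; apply: le_trans le1; exact: word_displacement.
exists K; first by have := E0; rewrite /K /K1; lra.
move=> P n PPP.
(* Append [j] letters, then split off the first [j] letters [u]: the remaining word [v] again has
   length [n] and is independent of [u]. *)
have window j : (j < m)%N -> Pw S mu n (fun l => K < f P (wprod l)) <=
    Ew S mu n (fun v => Pw S mu j (fun u =>
      K1 < f (act (wprod u)^-1%g @` P) (wprod v))).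
  move=> jm; pose B l :=
    K1 < f (act (wprod (take j l))^-1%g @` P) (wprod (drop j l)).
  have BE u v : u \in words S j ->
      B (u ++ v) = (K1 < f (act (wprod u)^-1%g @` P) (wprod v)).
    by move=> /mem_words[uj _]; rewrite /B -uj take_size_cat// drop_size_cat.
  rewrite -(@Pw_take _ _ _ _ mu_sum n (j + n) _ (leq_addl _ _)).
  apply: (@le_trans _ _ (Pw S mu (j + n) B)).
    apply: Pw_sub => // l /mem_words[ln lS]; rewrite /B => Kl.
    have [uS uL _] : [/\ {subset take j l <= S},
        L * (size (take j l))%:R <= L * m' & mdist p (act (wprod (take j l)) p)
          <= L * m'].
      apply: (word_le j) => //.
      have := @words_mem _ S (take j l) (fun h hl => lS h (mem_take hl)).
      by rewrite size_takel// ln leq_addr.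
    have dS : {subset drop n l <= S} by move=> h /mem_drop/lS.
    have := fM (wprod (take j l)) (wprod (drop j l)) PPP.
    rewrite -wprod_cat cat_take_drop => le1.
    have := f_lip 1%g PPP uS; rewrite !mul1g; have [-> _ _] := act_isom.
    rewrite -/(f P _) => le2.
    have := f_lip (wprod (take n l)) PPP dS.
    rewrite -wprod_cat cat_take_drop size_drop ln addnK => le3.
    have := pdist_triangle proj P p (act (wprod l) p) (act (wprod (take n l)) p).
    rewrite (pdistC _ _ (act (wprod l) p)) -/(f P _) -/(f P _).
    have : L * j%:R <= L * m' by rewrite ler_wpM2l// m'E ler_nat ltnW.
    by move: Kl; rewrite /K; lra.
  rewrite Pw_cat -exchange_Ew; apply: Ew_le => // v _.
  by apply: Pw_sub => // u uj; rewrite BE.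
apply: (@le_trans _ _ (m'^-1 * \sum_(0 <= j < m) Pw S mu n (fun l => K < f P
  (wprod l)))).
  by rewrite sumr_const_nat subn0 -mulr_natl -m'E mulKf ?gt_eqF.
apply: (@le_trans _ _ (m'^-1 * \sum_(0 <= j < m) Ew S mu n (fun v => Pw S mu j
  (fun u =>
      K1 < f (act (wprod u)^-1%g @` P) (wprod v))))).
  rewrite ler_wpM2l ?invr_ge0 ?(ltW m'0)//; apply: ler_sum_nat => j /andP[_ jm].
  exact: window.
rewrite -Ew_sum -EwZ -[leRHS](Ew_cst mu_sum n); apply: Ew_le => // v _.
have [[j [u [jm uj Ku]]]|none] := pselect (exists j u,
    [/\ (j < m)%N, u \in words S j & K1 < f (act (wprod u)^-1%g @` P) (wprod v)]);
    last first.
  rewrite big_nat big1 ?mulr0 ?divr_ge0 ?ler0n// => j /andP[_ jm].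
  rewrite /Pw -[RHS](Ew_cst mu_sum j); apply: eq_Ew => u uj.
  by rewrite asboolF// => Ku; apply: none; exists j, u.
(* For this [v], every prefix that counts yields the same translate [Q], that is, it carries [Q] to
   [P]. *)
set Q := act _ @` P in Ku; have PPQ : PP Q by exact: act_PP.
apply: le_trans (occ P Q PPQ); rewrite /occupation.
rewrite -m'E ler_wpM2l ?invr_ge0 ?(ltW m'0)//; apply: ler_sum_nat => i /andP[_ im].
apply: Pw_sub => // w wi Kw.
suff -> : Q = act (wprod w)^-1%g @` P by rewrite act_imageVK.
set Q' := act _ @` P in Kw *; have PPQ' : PP Q' by exact: act_PP.
apply: contrapT => QQ'.
have [_ _ ud] := word_le _ _ jm uj; have [_ _ wd] := word_le _ _ im wi.
have := proj_act_dist ps act_isom act_PP p (wprod u)^-1%g PPP.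
have := proj_act_dist ps act_isom act_PP p (wprod w)^-1%g PPP.
rewrite -/Q -/Q' !(mdistV act_isom) !ler_norml => /andP[? ?] /andP[? ?].
apply: (proj_exclusive ps PPQ PPQ' QQ' _ Ku Kw).
by rewrite ler_norml; apply/andP; split; lra.
Qed.

(** The probability that the walk from [g] visits [B] within [n] steps, time 0 included. The
    recursion on the first step turns the strong Markov property into an induction. *)
Fixpoint reach (B : G -> Prop) n g : R :=
  if `[< B g >] then 1
  else if n is n'.+1 then \sum_(h <- S) mu h * reach B n' (g * h)%g else 0.

(* With K' the constant of tightness, enlarged by the error of equivariance: after
   the first time that the projection passes t + K', both overshooting
   t + 2 K' + L + c and falling back below t require it to move by more than K',
   which has probability at most 2/5. *)
Lemma projection_contraction : exists2 K : R, 0 <= K & forall P n (t : R),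
  PP P -> 0 <= t ->
  Pw S mu n (fun l => t + K < f P (wprod l)) <=
  2 / 3 * Pw S mu n (fun l => t < f P (wprod l)).
Proof.
have c0 := ps_ge0 ps; have E0' := E0.
have [K0 K00 tight] := projection_tight.
have [K KE] : {K | K = K0 + E} by exists (K0 + E).
have K_ge0 : 0 <= K by rewrite KE addr_ge0.
exists (2 * K + L + c); first by have := L0; lra.
move=> P n t PPP t0.
pose B g := t + K < f P g.
have tightP g m : Pw S mu m (fun l =>
    K < pdist proj P (act g p) (act (g * wprod l)%g p)) <= 2 / 5.
  apply: le_trans (tight _ m (act_PP g^-1%g PPP)); apply: Pw_sub => // l _ Kl.
  have := pdist_shift ps act_isom act_PP p g (wprod l) PPP.
  by move: Kl; rewrite -/(f _ _) KE /E; lra.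
(* One step changes the projection by at most [L + c], so the bound on [f P g] persists until the
   first entry into [B]. Together with [down], the factors [2 / 5] and [3 / 5] give the ratio
   [2 / 3]. *)
have up g m : f P g <= t + K + L + c ->
    Pw S mu m (fun l => t + (2 * K + L + c) < f P (g * wprod l)%g) <=
    2 / 5 * reach B m g.
  elim: m g => [|m IH] g fg /=; case: asboolP => Bg.
  - rewrite mulr1; apply: le_trans (tightP g 0%N); apply: Pw_sub => // l _ fl.
    have := f_triangle P g (g * wprod l)%g.
    by move: fl fg; lra.
  - rewrite mulr0 /Pw Ew0 asboolF// wprod_nil mulg1.
    by move: Bg; rewrite /B; lra.
  - rewrite mulr1; apply: le_trans (tightP g m.+1); apply: Pw_sub => // l _ fl.
    have := f_triangle P g (g * wprod l)%g.
    by move: fl fg; lra.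
  - rewrite big_distrr/= /Pw EwS !big_seq; apply: ler_sum => h hS.
    rewrite mulrCA ler_wpM2l//.
    have /IH : f P (g * h)%g <= t + K + L + c.
      have hS' : {subset [:: h] <= S} by move=> x; rewrite inE => /eqP ->.
      have := f_lip g PPP hS'; rewrite wprod_cons wprod_nil mulg1 mulr1 => le1.
      have := f_triangle P g (g * h)%g.
      by move: Bg; rewrite /B => /negP; rewrite -leNgt; lra.
    apply: le_trans; apply: Ew_le => // l _.
    by rewrite wprod_cons mulgA.
have down g m : 3 / 5 * reach B m g <=
    Pw S mu m (fun l => t < f P (g * wprod l)%g).
  have hit g' m' : B g' ->
      3 / 5 * 1 <= Pw S mu m' (fun l => t < f P (g' * wprod l)%g).
    move=> Bg; have := Pw_not mu_sum m' (fun l => t < f P (g' * wprod l)%g).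
    suff : Pw S mu m' (fun l => ~ t < f P (g' * wprod l)%g) <= 2 / 5 by lra.
    apply: le_trans (tightP g' m'); apply: Pw_sub => // l _ fl.
    have := f_triangler P g' (g' * wprod l)%g.
    by move: Bg; rewrite /B; move: fl => /negP; rewrite -leNgt; lra.
  elim: m g => [|m IH] g /=; case: asboolP => Bg; try exact: hit.
    by rewrite mulr0; exact: Pw_ge0.
  rewrite big_distrr/= [leRHS]/Pw EwS !big_seq; apply: ler_sum => h hS.
  rewrite mulrCA ler_wpM2l//; apply: (le_trans (IH _)).
  by apply: Ew_le => // l _; rewrite wprod_cons mulgA.
have one (A : G -> Prop) : Pw S mu n (fun l => A (1 * wprod l)%g) =
    Pw S mu n (fun l => A (wprod l)).
  by apply: eq_Ew => l _; rewrite mul1g.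
have := up 1%g n; have := down 1%g n; rewrite f1.
rewrite (one (fun g => t < f P g)) (one (fun g => t + (2 * K + L + c) < f P g)).
move=> le1 le2; have /le2 : 0 <= t + K + L + c by have := L0; lra.
lra.
Qed.

Lemma projection_tail : exists2 K : R, 0 <= K & forall P n i, PP P ->
  Pw S mu n (fun l => i%:R * K < f P (wprod l)) <= (2 / 3) ^+ i.
Proof.
have [K K0 contr] := projection_contraction.
exists K => // P n i PPP; elim: i => [|i IH]; first exact: Pw_le1.
rewrite exprS; have t0 : 0 <= i%:R * K by rewrite mulr_ge0.
have -> : i.+1%:R * K = i%:R * K + K by rewrite -[i.+1%:R]natr1 mulrDl mul1r.
apply: le_trans (contr P n _ PPP t0) _.
by rewrite ler_wpM2l// divr_ge0.
Qed.

(* A peripheral set with a large projection becomes visible at the first time i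
   at which its projection passes a fixed level; there are then only linearly
   many candidates, and each of them has to be followed by the rest of the walk. *)
Lemma all_projections_tail : exists K C : R,
  [/\ 0 <= K, 0 <= C & forall n i,
    Pw S mu n (fun l => exists2 P, PP P & i%:R * K + C < f P (wprod l)) <=
    n.+1%:R * (Num.truncn (L * n%:R)).+1%:R * (2 / 3) ^+ i].
Proof.
have c0 := ps_ge0 ps; have E0' := E0.
have [K K0 tail] := projection_tail.
have [F FP] := choice (fun g => long_components ps p (act g p)).
exists K, (2 * c + 1 + L + E); split => //; first by have := L0; lra.
move=> n i; set N := Num.truncn _.
(* A candidate is given by a time [j] and an integer parameter [k] on a geodesic from [p] to its
   position at time [j], whose length is at most [L * n]. *)
pose r := [seq (j, k) | j <- iota 0 n.+1, k <- iota 0 N.+1].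
pose A (jk : nat * nat) l := let P := F (wprod (take jk.1 l)) jk.2 in
  PP P /\ i%:R * K < f (act (wprod (take jk.1 l))^-1%g @` P) (wprod (drop jk.1 l)).
apply: (@le_trans _ _ (Pw S mu n (fun l => exists2 jk, jk \in r & A jk l))).
  apply: Pw_sub => // l /mem_words[ln lS] [P PPP Pl].
  pose far j := c + 1 < f P (wprod (take j l)).
  have farn : far n by rewrite /far -ln take_size; have := L0; have :=
    mulr_ge0 (ler0n R i) K0; lra.
  have exfar : exists j, far j by exists n.
  case: (ex_minnP exfar) => j farj jmin.
  have jn : (j <= n)%N by exact: jmin.
  have tS : {subset take j l <= S} by move=> h /mem_take/lS.
  have [k kle Fk] := FP _ P PPP farj.
  exists (j, k).
    apply/allpairsP; exists (j, k); rewrite !mem_iota !add0n !ltnS jn; split => //=.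
    have := word_displacement tS; rewrite size_takel ?ln// => le1.
    rewrite /N truncn_ge_nat ?mulr_ge0//.
    by rewrite (le_trans kle)// (le_trans le1)// ler_wpM2l// ler_nat.
  rewrite /A /= Fk; split => //.
  (* Just before time [j] the projection is at most [c + 1], and one step adds at most [L + c]. *)
  have fj : f P (wprod (take j l)) <= c + 1 + L + c.
    case: j farj jmin jn {tS kle Fk} => [|j] farj jmin jn.
      by move: farj; rewrite /far take0 wprod_nil f1; lra.
    have nfar : f P (wprod (take j l)) <= c + 1.
      by rewrite leNgt; apply/negP => /jmin; rewrite ltnn.
    have jl : (j < size l)%N by rewrite ln.
    rewrite (take_nth 1%g jl) wprod_rcons.
    have hS : {subset [:: nth 1%g l j] <= S}.
      by move=> h; rewrite inE => /eqP ->; apply/lS/mem_nth.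
    have := f_lip (wprod (take j l)) PPP hS.
    rewrite wprod_cons wprod_nil mulg1 mulr1 => le1.
    have := f_triangle P (wprod (take j l)) (wprod (take j l) * nth 1%g l j)%g.
    lra.
  have := fM (wprod (take j l)) (wprod (drop j l)) PPP.
  by rewrite -wprod_cat cat_take_drop; lra.
apply: (le_trans (Pw_exists _ mu_ge0 _ _ _)).
apply: (@le_trans _ _ (\sum_(jk <- r) (2 / 3) ^+ i)).
  rewrite !big_seq; apply: ler_sum => jk /allpairsP[[j k]].
  rewrite !mem_iota !add0n !ltnS /= => -[jn kN ->].
  (* Once the first [j] letters are fixed the candidate is a fixed set, and the remaining letters
     are independent of it. *)
  rewrite -(subnKC jn) Pw_cat -[leRHS](Ew_cst mu_sum j).
  apply: Ew_le => // u /mem_words[uj uS].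
  have [PPP|nPP] := pselect (PP (F (wprod u) k)); last first.
    apply: (@le_trans _ _ (Pw S mu (n - j) (fun=> False))).
      by apply: Pw_sub => // v _; rewrite /A/= -uj take_size_cat// => -[].
    rewrite /Pw (@eq_Ew _ _ _ _ _ _ (fun=> 0)) => [|v _]; last by rewrite asboolF.
    by rewrite Ew_cst// exprn_ge0// divr_ge0.
  apply: le_trans (tail _ (n - j)%N i (act_PP (wprod u)^-1%g PPP)).
  by apply: Pw_sub => // v _;
    rewrite /A/= -uj take_size_cat// drop_size_cat// => -[].
by rewrite big_const_seq count_predT iter_addr_0 size_allpairs !size_iota
  -natrM -[leLHS]mulr_natl.
Qed.

End ProjectionTail.

(** * Orbits of peripheral sets *)

Section Generation.
Context (G : groupType) (S : seq G).
Hypothesis SV : forall g, g \in S -> g^-1%g \in S.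

Lemma wprodV (l : seq G) : {subset l <= S} ->
  exists2 l', {subset l' <= S} & wprod l' = (wprod l)^-1%g.
Proof.
elim: l => [|g l IH] lS; first by exists [::]; rewrite // wprod_nil invg1.
have [|l' l'S l'E] := IH; first by move=> h hl; apply: lS; rewrite inE hl orbT.
exists (rcons l' g^-1%g); last by rewrite wprod_rcons wprod_cons invgM l'E.
move=> h; rewrite mem_rcons inE => /predU1P[->|/l'S//].
by apply/SV/lS; rewrite mem_head.
Qed.

Lemma generates_words : generates [set` S] ->
  forall g, exists2 l, {subset l <= S} & wprod l = g.
Proof.
move=> gen g.
pose H : {pred G} := [pred h | `[< exists2 l, {subset l <= S} & wprod l = h >]].
have HE h : (h \in H) = `[< exists2 l, {subset l <= S} & wprod l = h >] by [].
suff : g \in H by rewrite HE => /asboolP.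
apply: gen.
  split; first by rewrite HE; apply/asboolP; exists [::]; rewrite // wprod_nil.
  move=> x y; rewrite !HE => /asboolP[l lS <-] /asboolP[l' l'S <-].
  have [l'' l''S l''E] := wprodV l'S.
  apply/asboolP; exists (l ++ l''); last by rewrite wprod_cat l''E.
  by move=> h; rewrite mem_cat => /orP[/lS|/l''S].
move=> h hS; rewrite HE; apply/asboolP; exists [:: h].
  by move=> k; rewrite inE => /eqP ->.
by rewrite wprod_cons wprod_nil mulg1.
Qed.

Lemma words_countable : (forall g, exists2 l, {subset l <= S} & wprod l = g) ->
  countable [set: G].
Proof.
move=> gen.
have [w wP] : {w & forall g, {subset w g <= S} /\ wprod (w g) = g}.
  apply: (@choice _ _ (fun g l => {subset l <= S} /\ wprod l = g)) => g.
  by have [l lS lE] := gen g; exists l.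
apply/countable_injP; exists (fun g => pickle (map (index^~ S) (w g))).
move=> g h _ _ /(pcan_inj pickleK) gh.
have idK l : {subset l <= S} -> map (nth 1%g S) (map (index^~ S) l) = l.
  by move=> lS; rewrite -map_comp map_id_in// => x /lS xS /=; rewrite nth_index.
have [gS <-] := wP g; have [hS <-] := wP h.
by rewrite -(idK _ gS) -(idK _ hS) gh.
Qed.

End Generation.

Section PeripheralOrbits.
Context (R : realType) (X : metricType R) (PP : set (set X)).
Context (proj : set X -> X -> X) (nu rho c : R).
Hypothesis ps : projection_system PP proj nu rho c.
Context (G : groupType) (act : G -> X -> X).
Hypothesis act_isom : isometric_action act.
Hypothesis act_PP : forall g P, PP P -> PP (act g @` P).
Hypothesis stab_unbounded : forall P, PP P ->
  unbounded_orbits act (stabiliser act P).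
Context (p : X).

(* Otherwise the projection of P to Q, which is bounded, would be coarsely
   invariant under the stabiliser of Q. *)
Lemma stabiliser_not_sub P Q : PP P -> PP Q -> P <> Q ->
  ~ stabiliser act Q `<=` stabiliser act P.
Proof.
move=> PPP PPQ PQ QP.
pose x := proj P p; have Px : P x by exact: (ps_mem ps).
(* [2 * c + 2] from [proj_other] plus [2 * c + 1] from [act_proj]. *)
have [h hQ far] := stab_unbounded PPQ (proj Q x) (4 * c + 3).
have Phx : P (act h x) by rewrite -(QP _ hQ); exists x.
have := proj_other ps PPQ PPP (nesym PQ) Px Phx.
have := act_proj ps act_isom act_PP x h PPQ; rewrite hQ.
have := metric_triangle (proj Q x) (proj Q (act h x)) (act h (proj Q x)).
by rewrite (metric_sym (act h _)); lra.
Qed.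

(** Some [h] stabilising [P] moves [proj P p] far, so [P] is one of the countably many sets with a
    long component on a geodesic from [p] to an orbit point. *)
Lemma peripheral_countable : countable [set: G] -> countable PP.
Proof.
move=> /countable_injP[fG fGinj].
have [F FP] := choice (fun g => long_components ps p (act g p)).
have cT : countable [set: G * nat].
  apply/countable_injP; exists (fun x => pickle (fG x.1, x.2)).
  move=> [g m] [h n] _ _ /= /(pcan_inj pickleK)[gh ->].
  by congr (_, _); apply: fGinj; rewrite ?inE.
pose Fu (x : G * nat) := F x.1 x.2.
apply: (@sub_countable _ _ _ (Fu @` setT)); last first.
  exact: sub_countable (card_image_le _ _) cT.
apply: subset_card_le => P PPP.
have [h hP far] := stab_unbounded PPP (proj P p) (3 * c + 2).
have := act_proj ps act_isom act_PP p h PPP; rewrite hP => near.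
have Pp : c + 1 < mdist (proj P p) (proj P (act h p)).
  have := metric_triangle (proj P p) (proj P (act h p)) (act h (proj P p)).
  by rewrite (metric_sym (proj P (act h p))); lra.
by have [k _ <-] := FP h P PPP Pp; exists (h, k).
Qed.

(** If the generators produced fewer than three sets from [P], its orbit would have at most two
    elements, and the stabiliser of another peripheral set would fix [P]. *)
Lemma peripheral_three (S : seq G) :
  (exists P Q, [/\ PP P, PP Q & P <> Q]) ->
  (forall g, exists2 l, {subset l <= S} & wprod l = g) ->
  forall P, PP P -> exists g h Q,
    [/\ g \in S, h \in S, Q = act h @` P \/ Q = act h @` (act g @` P) &
        [/\ P <> act g @` P, P <> Q & act g @` P <> Q]].
Proof.
move=> [P1 [P2 [PP1 PP2 P12]]] gen P PPP.
have [Q PPQ PQ] : exists2 Q, PP Q & P <> Q.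
  have [PP1'|] := pselect (P = P1); last by exists P1.
  by exists P2 => //; rewrite PP1'.
have closed_orbit (D : set (set X)) :
    (forall g Q, g \in S -> D Q -> D (act g @` Q)) ->
    forall g Q, D Q -> D (act g @` Q).
  move=> DS g; have [l lS <-] := gen g; elim: l lS => [|h l IH] lS T DT.
    by rewrite wprod_nil (act_image1 act_isom).
  rewrite wprod_cons (act_imageM act_isom); apply: DS.
    by apply: lS; rewrite mem_head.
  by apply: IH => // k kl; apply: lS; rewrite inE kl orbT.
have [[g gS gP]|fixP] := pselect (exists2 g, g \in S & P <> act g @` P); last first.
  exfalso; apply: (stabiliser_not_sub PPP PPQ PQ) => h _.
  apply: (closed_orbit [set P] _ h P) => // g _ gS ->.
  by apply: contrapT => gP; apply: fixP; exists g => //; exact: nesym.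
set P' := act g @` P in gP *.
have [[h [T [hS TE PT P'T]]]|none] := pselect (exists h T,
    [/\ h \in S, T = act h @` P \/ T = act h @` P', P <> T & P' <> T]).
  by exists g, h, T.
exfalso; apply: (stabiliser_not_sub PPP (act_PP g PPP) gP) => h hP'.
(* Without a third set the generators preserve the pair [P], [P'], hence so does [h]. *)
have [//|hPP'] : [set T | T = P \/ T = P'] (act h @` P).
  apply: closed_orbit; last by left.
  move=> k T kS TE /=; apply: contrapT => /not_orP[nP nP']; apply: none.
  exists k, (act k @` T); split => //; [|exact: nesym|exact: nesym].
  by case: TE => ->; [left|right].
(* Here [h] maps both [P] and [P'] to [P'], so they coincide. *)
exfalso; apply: gP.
by rewrite -[P](act_imageK act_isom h) hPP' -[P' in LHS]hP' act_imageK.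
Qed.

End PeripheralOrbits.

(** * Logarithmic tracking *)

Section DeterministicTracking.
Context (R : realType) (X : metricType R) (PP : set (set X)).
Context (proj : set X -> X -> X) (nu rho c D : R).
Hypothesis ps : projection_system PP proj nu rho c.
Hypothesis PPcountable : countable PP.
Hypothesis rho0 : 0 <= rho.
Hypothesis D0 : 0 <= D.
Hypothesis thin : forall x y z gxy gxz gzy,
  geodesic x y gxy -> geodesic x z gxz -> geodesic z y gzy ->
  trans PP nu rho x y gxy `<=`
    nbhd D (trans PP nu rho x z gxz `|` trans PP nu rho z y gzy).

(* With r about log n and b a bound on the projections, the transient points lie
   within trans_radius of the path, the geodesic within path_radius of it, and
   the path within track_radius of the transient points. *)
Definition trans_radius (L : R) (r : nat) : R := r%:R * D + L.
Definition path_radius L r (b : R) : R := trans_radius L r + (b + 2 * c + 1).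
Definition track_radius L r b W : R :=
  path_radius L r b + L * W + (b + 2 * c + 1).

Lemma dHaus_path (L : R) (f : nat -> X) n r (b W : R) g :
  0 <= L -> 0 <= b -> 0 <= W -> (n <= 2 ^ r)%N ->
  (forall j, mdist (f j) (f j.+1) <= L) ->
  (forall P, PP P -> mdist (proj P (f 0%N)) (proj P (f n)) <= b) ->
  (forall j k, (j <= k <= n)%N ->
     mdist (f j) (f k) <= 2 * path_radius L r b + 1 -> (k - j)%:R <= W) ->
  geodesic (f 0%N) (f n) g ->
  let A := [set f i | i in [set i | (i <= n)%N]] in
  (dHaus A (trans PP nu rho (f 0%N) (f n) g) <= (track_radius L r b W + 1)%:E)%E /\
  (dHaus A (geodesic_seg (f 0%N) (f n) g) <= (track_radius L r b W + 1)%:E)%E.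
Proof.
move=> L0 b0 W0 nr fL Pb prog gg A; have c0 := ps_ge0 ps.
have LW0 : 0 <= L * W by exact: mulr_ge0.
have t0 : 0 <= trans_radius L r.
  by rewrite addr_ge0// mulr_ge0.
have trans_path q : trans PP nu rho (f 0%N) (f n) g q ->
    exists2 j, (j <= n)%N & mdist q (f j) <= trans_radius L r.
  move=> tq; have := @trans_near_path _ _ _ _ _ _ _ _ fL r n 0 g q
    (ps_geodesic ps) D0 thin nr.
  by rewrite add0n => /(_ gg tq)[j /andP[_ jn] jq]; exists j.
have near_trans t : 0 <= t <= mdist (f 0%N) (f n) ->
    exists2 q, trans PP nu rho (f 0%N) (f n) g q & mdist (g t) q <= b + 2 * c + 1.
  exact: (geodesic_near_trans ps rho0 PPcountable b0 gg Pb).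
have seg_path t : 0 <= t <= mdist (f 0%N) (f n) ->
    exists2 j, (j <= n)%N & mdist (g t) (f j) <= path_radius L r b.
  move=> /near_trans[q /trans_path[j jn jq] tq]; exists j => //.
  by have := metric_triangle (g t) q (f j); rewrite /path_radius; lra.
have r0 : 0 <= path_radius L r b by rewrite /path_radius; lra.
have path_seg i : (i <= n)%N -> exists2 t, 0 <= t <= mdist (f 0%N) (f n) &
    mdist (g t) (f i) <= path_radius L r b + L * W.
  exact: (path_near_geodesic fL L0 r0 gg seg_path prog).
split; apply: (@dHaus_le _ _ _ _ (track_radius L r b W));
  rewrite /track_radius; try lra.
- move=> _ [i /= /path_seg[t /near_trans[q tq qt] ti] <-]; exists q => //.
  have := metric_triangle (f i) (g t) q; rewrite (metric_sym (f i) (g t)); lra.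
- move=> q /trans_path[j jn jq]; exists (f j); first by exists j.
  by move: r0 t0; rewrite /path_radius; lra.
- move=> _ [i /= /path_seg[t tt ti] <-]; exists (g t).
    by exists t => //=; rewrite in_itv.
  by rewrite metric_sym; lra.
- move=> _ [t /= + <-]; rewrite in_itv/= => /seg_path[j jn jt].
  by exists (f j); [exists j|lra].
Qed.

End DeterministicTracking.

Lemma log_radius_bound (R : realType) (c D L C0 e A1 A2 : R) :
  0 <= c -> 0 <= D -> 0 <= L -> 0 <= C0 -> 0 <= e -> 0 <= A1 -> 0 <= A2 ->
  exists2 B : R, 0 <= B & forall (x b M : R) (r : nat), 1 <= 2 * x ->
    r%:R <= 4 * x -> b <= A1 * x -> M <= A2 * x ->
    track_radius c D L r b (M + C0 * (2 * path_radius c D L r b + 1 + e)) + 1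
    <= B * x.
Proof.
move=> c0 D0 L0 C00 e0 A10 A20.
(* [b1 * x] bounds the path radius and [b2 * x] the admissible time gap; a constant [a] is absorbed
   as [2 * a * x]. *)
have [b1 b1E] : {b1 | b1 = 4 * D + 2 * L + A1 + 2 * (2 * c + 1)} by eexists.
have [b2 b2E] : {b2 | b2 = A2 + C0 * (2 * b1 + 2 * (1 + e))} by eexists.
have b10 : 0 <= b1 by rewrite b1E; lra.
have b20 : 0 <= b2 by rewrite b2E addr_ge0// mulr_ge0//; lra.
have lb2 : 0 <= L * b2 by exact: mulr_ge0.
exists (b1 + L * b2 + A1 + 2 * (2 * c + 1) + 2); first lra.
move=> x b M r x1 rx bx Mx.
have scale a : 0 <= a -> a <= 2 * a * x.
  by move=> a0; have := ler_wpM2l a0 x1; rewrite mulr1 mulrA (mulrC a 2).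
have rD : r%:R * D <= 4 * D * x.
  by have := ler_wpM2r D0 rx; lra.
have p1 : path_radius c D L r b <= b1 * x.
  rewrite /path_radius /trans_radius b1E.
  have := scale _ L0; have c21 : 0 <= 2 * c + 1 by lra.
  by have := scale _ c21; lra.
have W1 : M + C0 * (2 * path_radius c D L r b + 1 + e) <= b2 * x.
  have -> : b2 * x = A2 * x + C0 * ((2 * b1 + 2 * (1 + e)) * x) by rewrite b2E;
    ring.
  rewrite lerD// ler_wpM2l//.
  have e1 : 0 <= 1 + e by lra.
  by have := scale _ e1; lra.
have LW : L * (M + C0 * (2 * path_radius c D L r b + 1 + e)) <= L * b2 * x.
  by rewrite -[L * b2 * x]mulrA ler_wpM2l.
rewrite /track_radius; have c21 : 0 <= 2 * c + 1 by lra.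
by have := scale _ c21; lra.
Qed.

Section LogarithmicTracking.
Context (R : realType) (X : metricType R) (PP : set (set X)).
Context (proj : set X -> X -> X) (nu rho c D : R).
Hypothesis ps : projection_system PP proj nu rho c.
Hypothesis PPcountable : countable PP.
Hypothesis rho0 : 0 <= rho.
Hypothesis D0 : 0 <= D.
Hypothesis thin : forall x y z gxy gxz gzy,
  geodesic x y gxy -> geodesic x z gxz -> geodesic z y gzy ->
  trans PP nu rho x y gxy `<=`
    nbhd D (trans PP nu rho x z gxz `|` trans PP nu rho z y gzy).
Context (G : groupType) (act : G -> X -> X).
Hypothesis act_isom : isometric_action act.
Hypothesis act_PP : forall g P, PP P -> PP (act g @` P).
Context (S : seq G) (mu : G -> R).
Hypothesis mu_sum : \sum_(g <- S) mu g = 1.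
Hypothesis mu_ge0 : forall g, 0 <= mu g.
Hypothesis mu_gt0 : forall g, g \in S -> 0 < mu g.
Hypothesis three : forall P, PP P -> exists g h Q,
  [/\ g \in S, h \in S, Q = act h @` P \/ Q = act h @` (act g @` P) &
      [/\ P <> act g @` P, P <> Q & act g @` P <> Q]].
Context (o p : X) (C0 : R).
Hypothesis C0_ge1 : 1 <= C0.
Hypothesis progress : forall n,
  Pw S mu n (fun l => mdist o (act (wprod l) o) <= n%:R / C0) <=
  C0 * expR (- (n%:R / C0)).

Definition slow n m (l : seq G) := exists2 ij : nat * nat,
  (ij.1 + m <= ij.2 <= n)%N &
  mdist (act (wprod (take ij.1 l)) o) (act (wprod (take ij.2 l)) o) <=
    (ij.2 - ij.1)%:R / C0.

(** A union bound over pairs of times: the displacement between times [i] and [j] has the law of a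
    walk of length [j - i], which is at least [m]. *)
Lemma slow_tail n m : Pw S mu n (slow n m) <=
  n.+1%:R * n.+1%:R * (C0 * expR (- (m%:R / C0))).
Proof.
have C00 : 0 < C0 by have := C0_ge1; lra.
pose r := [seq ij <- [seq (i, j) | i <- iota 0 n.+1, j <- iota 0 n.+1] |
  (ij.1 + m <= ij.2 <= n)%N].
pose A (ij : nat * nat) (l : seq G) :=
  mdist o (act (wprod (drop ij.1 (take ij.2 l))) o) <=
  (ij.2 - ij.1)%:R / C0.
apply: (@le_trans _ _ (Pw S mu n (fun l => exists2 ij, ij \in r & A ij l))).
  apply: Pw_sub => // l /mem_words[ln lS] [[i j] /= /andP[ij jn] dij].
  exists (i, j).
    rewrite mem_filter; apply/andP; split; first by rewrite /= ij.
    apply/allpairsP; exists (i, j).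
    by rewrite !mem_iota !add0n !ltnS jn; split => //=; lia.
  rewrite /A/=; apply: le_trans dij.
  have -> : take i l = take i (take j l) by rewrite take_takel//; lia.
  rewrite -{3}(cat_take_drop i (take j l)) wprod_cat (actM act_isom).
  by rewrite (mdist_act act_isom).
apply: (le_trans (Pw_exists _ mu_ge0 _ _ _)).
apply: (@le_trans _ _ (\sum_(ij <- r) (C0 * expR (- (m%:R / C0))))).
  rewrite !big_seq; apply: ler_sum => -[i j];
    rewrite mem_filter/= => /andP[/andP[ij jn] _].
  rewrite (@Pw_take _ _ _ _ mu_sum j n (fun l => mdist o (act (wprod (drop i
    l)) o) <= (j - i)%:R / C0))//.
  rewrite (@Pw_drop _ _ _ _ mu_sum i j (fun l => mdist o (act (wprod l) o) <=
    (j - i)%:R / C0)); last lia.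
  apply: (le_trans (progress _)); rewrite ler_pM2l// ler_expR lerN2.
  by rewrite ler_pM2r ?invr_gt0// ler_nat; lia.
rewrite big_const_seq count_predT iter_addr_0 -natrM -[leLHS]mulr_natl.
rewrite ler_wpM2r ?mulr_ge0 ?expR_ge0 ?(ltW C00)// ler_nat.
by rewrite size_filter (leq_trans (count_size _ _))// size_allpairs !size_iota.
Qed.

Definition walk_path n (l : seq G) : set X :=
  [set act (wprod (take i l)) p | i in [set i | (i <= n)%N]].

Definition tracked n (x : R) (l : seq G) :=
  forall g, geodesic p (act (wprod l) p) g ->
  (dHaus (walk_path n l) (trans PP nu rho p (act (wprod l) p) g) <= x%:E)%E /\
  (dHaus (walk_path n l) (geodesic_seg p (act (wprod l) p) g) <= x%:E)%E.

Lemma tracking_tail (k : R) : 1 <= k -> exists B C : R, forall n, (2 <= n)%N ->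
  Pw S mu n (fun l => ~ tracked n (B * ln n%:R) l) <= C * n%:R `^ (- k).
Proof.
move=> k1; have C00 : 0 < C0 by have := C0_ge1; lra.
have c0 := ps_ge0 ps.
have [L L0 step_le] : exists2 L : R, 0 <= L & forall g, g \in S ->
  mdist p (act g p) <= L.
  elim: (S) => [|g r [L L0 IH]]; first by exists 0.
  exists (Num.max L (mdist p (act g p))); first by rewrite le_max L0.
  by move=> h; rewrite inE le_max => /predU1P[->|/IH ->//]; rewrite lexx orbT.
have [K [C [K0 CC0 tail]]] :=
  all_projections_tail ps act_isom act_PP mu_sum mu_ge0 mu_gt0 L0 step_le three.
pose A1 := (3 * (k + 2) + 2) * K + 2 * C.
pose A2 := C0 * (k + 2) + 2.
have A10 : 0 <= A1 by rewrite /A1 addr_ge0 ?mulr_ge0//; lra.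
have A20 : 0 <= A2 by rewrite /A2 addr_ge0 ?mulr_ge0//; lra.
have e0 : 0 <= 2 * mdist o p by rewrite mulr_ge0 ?mdist_ge0.
have [B B0 HB] := log_radius_bound c0 D0 L0 (ltW C00) e0 A10 A20.
exists B, (2 * (L + 1) + 4 * C0) => n n2.
set x := ln n%:R.
have n0 : 0 < n%:R :> R by rewrite ltr0n (leq_trans _ n2).
have ln2 : 1 <= 2 * ln 2 :> R.
  have : 2^-1 <= expR (- 2^-1) :> R.
    by have := expR_ge1Dx (- 2^-1 : R); lra.
  rewrite expRN lef_pV2 ?posrE ?expR_gt0// => e2.
  have : ln (expR 2^-1) <= ln (2 : R) by rewrite ler_ln ?posrE ?expR_gt0.
  by rewrite expRK; lra.
have x1 : 1 <= 2 * x.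
  apply: le_trans ln2 _; rewrite ler_pM2l// ler_ln ?posrE//.
  by rewrite ler_nat.
(* With these [i] and [m], both [(2 / 3) ^+ i] and [expR (- (m%:R / C0))] are at most [n] to the
   power [-(k + 2)]; the extra 2 pays for the quadratic factors of the union bounds. *)
pose i := (Num.truncn (3 * (k + 2) * x)).+1.
pose m := (Num.truncn (C0 * (k + 2) * x)).+1.
pose r := (trunc_log 2 n).+1.
have trunc_le (y : R) : 0 <= y -> (Num.truncn y).+1%:R <= y + 1.
  by move=> /truncn_itv/andP[? _]; rewrite -natr1; lra.
have i_le : i%:R <= 3 * (k + 2) * x + 1.
  by apply: trunc_le; rewrite !mulr_ge0//; lra.
have m_le : m%:R <= C0 * (k + 2) * x + 1.
  by apply: trunc_le; rewrite !mulr_ge0//; lra.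
have i_ge : 3 * (k + 2) * x <= i%:R by exact/ltW/truncnS_gt.
have m_ge : C0 * (k + 2) * x <= m%:R by exact/ltW/truncnS_gt.
have r_le : r%:R <= 4 * x.
  have : ln 2 *+ trunc_log 2 n <= x.
    by rewrite -(@lnXn R)// ler_ln ?posrE ?exprn_gt0// -natrX ler_nat
      trunc_logP// (leq_trans _ n2).
  have -> : r%:R = (trunc_log 2 n)%:R + 1 :> R by rewrite natr1.
  rewrite -[ln 2 *+ _]mulr_natl => le1.
  have : (trunc_log 2 n)%:R * 1 <= (trunc_log 2 n)%:R * (2 * ln 2) :> R.
    by rewrite ler_wpM2l.
  lra.
pose far l := exists2 P, PP P & i%:R * K + C < pdist proj P p (act (wprod l) p).
have incl : {in words S n, forall l, ~ tracked n (B * x) l ->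
    exists2 b : bool, b \in [:: true; false] & (if b then far else slow n m) l}.
  move=> l /mem_words[ln lS] ntr; apply: contrapT => nfs.
  have near P : PP P -> pdist proj P p (act (wprod l) p) <= i%:R * K + C.
    move=> PPP; rewrite leNgt; apply/negP => Pl.
    by apply: nfs; exists true => //; exists P.
  have fast j1 j2 : (j1 + m <= j2 <= n)%N -> (j2 - j1)%:R / C0 <
      mdist (act (wprod (take j1 l)) o) (act (wprod (take j2 l)) o).
    move=> j12; rewrite ltNge; apply/negP => le1.
    by apply: nfs; exists false => //; exists (j1, j2).
  apply: ntr => g gg; pose f j := act (wprod (take j l)) p.
  have f0 : f 0%N = p by rewrite /f take0 wprod_nil; case: act_isom.
  have fn : f n = act (wprod l) p by rewrite /f -ln take_size.
  have fL j : mdist (f j) (f j.+1) <= L.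
    have [jl|lj] := ltnP j (size l); last first.
      by rewrite /f !take_oversize ?mdistxx// (leq_trans lj).
    rewrite /f (take_nth 1%g jl) wprod_rcons (actM act_isom) (mdist_act act_isom).
    exact/step_le/lS/mem_nth.
  pose b := i%:R * K + C.
  have b0 : 0 <= b by rewrite addr_ge0// mulr_ge0.
  (* Gaps up to [m] are always allowed and longer ones are controlled by progress. That is known at
     the base point [o]; passing to [p] costs [mdist o p] at each end. *)
  pose W := m%:R + C0 * (2 * path_radius c D L r b + 1 + 2 * mdist o p).
  have pr0 : 0 <= path_radius c D L r b.
    by rewrite /path_radius /trans_radius !addr_ge0// ?mulr_ge0.
  have CW0 : 0 <= C0 * (2 * path_radius c D L r b + 1 + 2 * mdist o p).
    by rewrite mulr_ge0 ?(ltW C00)// !addr_ge0// ?mulr_ge0.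
  have W0 : 0 <= W by rewrite addr_ge0.
  have prog j1 j2 : (j1 <= j2 <= n)%N ->
      mdist (f j1) (f j2) <= 2 * path_radius c D L r b + 1 -> (j2 - j1)%:R <= W.
    move=> /andP[j12 j2n] close; have [small|big] := leqP (j2 - j1) m.
      by rewrite /W (le_trans (_ : _ <= m%:R)) ?ler_nat ?lerDl.
    have /fast : (j1 + m <= j2 <= n)%N by rewrite j2n andbT ltnW// -ltn_subRL.
    have o_f j : mdist (act (wprod (take j l)) o) (f j) = mdist o p.
      exact: (mdist_act act_isom).
    have := metric_triangle (act (wprod (take j1 l)) o) (f j1) (act (wprod
      (take j2 l)) o).
    have := metric_triangle (f j1) (f j2) (act (wprod (take j2 l)) o).
    rewrite (metric_sym (f j2)) !o_f => le1 le2 lt3.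
    have : (j2 - j1)%:R / C0 <= 2 * path_radius c D L r b + 1 + 2 * mdist o p.
      by lra.
    by rewrite ler_pdivrMr// mulrC => le4; rewrite /W; apply: le_trans le4 _;
      rewrite lerDr.
  have nr : (n <= 2 ^ r)%N by exact/ltnW/trunc_log_ltn.
  have near' P : PP P -> mdist (proj P (f 0%N)) (proj P (f n)) <= b.
    by rewrite f0 fn; exact: near.
  have gg' : geodesic (f 0%N) (f n) g by rewrite f0 fn.
  have := dHaus_path ps PPcountable rho0 D0 thin L0 b0 W0 nr fL near' prog gg'.
  rewrite /= f0 fn -/(walk_path n l) => -[tr seg].
  have Kx : K <= 2 * K * x by have := ler_wpM2l K0 x1; lra.
  have Cx : C <= 2 * C * x by have := ler_wpM2l CC0 x1; lra.
  have bx : b <= A1 * x.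
    by rewrite /b /A1; have := ler_wpM2r K0 i_le; lra.
  have mx : m%:R <= A2 * x by rewrite /A2; lra.
  have := HB _ _ _ _ x1 r_le bx mx => le1.
  by split; [apply: le_trans tr _|apply: le_trans seg _]; rewrite lee_fin.
apply: (@le_trans _ _ (Pw S mu n far + Pw S mu n (slow n m))).
  apply: (le_trans (Pw_sub mu_ge0 incl)).
  apply: le_trans (Pw_exists _ mu_ge0 _ _ _) _.
  by rewrite !big_cons big_nil addr0.
pose q : R := expR (- ((k + 2) * x)).
have nx : n%:R = expR x by rewrite lnK.
have -> : n%:R `^ (- k) = n%:R * n%:R * q.
  rewrite /powR gt_eqF// nx expRK /q -!expRD; congr expR; lra.
have q0 : 0 <= q by exact: expR_ge0.
have far_le : Pw S mu n far <= 2 * (L + 1) * (n%:R * n%:R * q).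
  apply: (le_trans (tail n i)).
  have qi : (2 / 3) ^+ i <= q.
    apply: (@le_trans _ _ (expR (- (1 / 3)) ^+ i)).
      have e23 : 2 / 3 <= expR (- (1 / 3)) :> R.
        by have := expR_ge1Dx (- (1 / 3) : R); lra.
      by rewrite lerXn2r ?nnegrE ?expR_ge0// divr_ge0.
    by rewrite -expRM_natl /q ler_expR; lra.
  have nS : n.+1%:R <= 2 * n%:R :> R
    by rewrite -natrM ler_nat mul2n -addnn -addn1 leq_add2l (leq_trans _ n2).
  have Ln : (Num.truncn (L * n%:R)).+1%:R <= (L + 1) * n%:R.
    apply: (le_trans (trunc_le _ _)); first by rewrite mulr_ge0// ltW.
    have : 1 <= n%:R :> R by rewrite ler1n (leq_trans _ n2).
    lra.
  have -> : 2 * (L + 1) * (n%:R * n%:R * q) = 2 * n%:R * ((L + 1) * n%:R) * q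
    by ring.
  by rewrite !ler_pM// ?mulr_ge0// exprn_ge0// divr_ge0.
have slow_le : Pw S mu n (slow n m) <= 4 * C0 * (n%:R * n%:R * q).
  apply: (le_trans (slow_tail n m)).
  have qm : expR (- (m%:R / C0)) <= q.
    rewrite /q ler_expR lerN2 ler_pdivlMr//.
    by move: m_ge; lra.
  have nS : n.+1%:R <= 2 * n%:R :> R
    by rewrite -natrM ler_nat mul2n -addnn -addn1 leq_add2l (leq_trans _ n2).
  have -> : 4 * C0 * (n%:R * n%:R * q) = 2 * n%:R * (2 * n%:R) * (C0 * q) by ring.
  by rewrite !ler_pM ?mulr_ge0 ?expR_ge0 ?(ltW C00).
lra.
Qed.

End LogarithmicTracking.

(** * Deduction of the theorem from its hypotheses *)

Lemma trans_constants_projection_system (R : realType) (X : metricType R)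
    (PP : set (set X)) (proj : set X -> X -> X) (nu rho : R) :
  geodesic_space X -> coarse_projection PP proj ->
  trans_constants PP proj nu rho ->
  exists c D : R, [/\ projection_system PP proj nu rho c, 0 <= rho, 0 <= D &
    forall x y z gxy gxz gzy,
      geodesic x y gxy -> geodesic x z gxz -> geodesic z y gzy ->
      trans PP nu rho x y gxy `<=`
        nbhd D (trans PP nu rho x z gxz `|` trans PP nu rho z y gzy)].
Proof.
move=> geoX projP [_ rho0 [D [t [C [thin comp]]]]].
exists (Num.max C 0), (Num.max D 0); split=> //; last 2 first.
- by rewrite le_max lexx orbT.
- move=> x y z gxy gxz gzy gg1 gg2 gg3 q /(thin _ _ _ _ _ _ gg1 gg2 gg3)[q' tq'
    qq'].
  by exists q' => //; rewrite lt_max qq'.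
split=> //.
- by rewrite le_max lexx orbT.
- by move=> P x PPP; have [] := projP P x PPP.
- move=> P x y PPP Py; have [_ /le_trans] := projP P x PPP; apply.
  rewrite lerD2r; apply: ge_inf; last by exists y.
  by exists 0 => _ [z _ <-]; exact: mdist_ge0.
- move=> x y g gg; have [Q [a [b dc]]] := comp x y g gg.
  exists Q, a, b; apply: deep_components_components gg dc.
  by rewrite le_max lexx.
Qed.

Lemma finite_support_seq (R : realType) (G : groupType) (mu : G -> R) :
  fin_supp_probability mu -> exists2 S : seq G, uniq S &
    [/\ msupport mu = [set` S], \sum_(g <- S) mu g = 1 &
        forall g, g \in S -> 0 < mu g].
Proof.
move=> [mu0 /finite_seqP[S SE] musum].
exists (undup S); first exact: undup_uniq.
have inS g : (g \in undup S) = (mu g != 0).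
  rewrite mem_undup; have : (msupport mu g) = [set` S] g by rewrite SE.
  by rewrite /msupport /= => gS; apply/idP/idP; rewrite gS.
split.
- by rewrite SE; apply/seteqP; split => g /=; rewrite mem_undup.
- rewrite -[RHS]musum (fsbigE (undup S)) ?undup_uniq//.
    by apply: eq_bigl => g; rewrite in_setT.
  by move=> g _; rewrite inS negbK => /eqP.
- by move=> g; rewrite inS lt_def mu0 andbT.
Qed.

Lemma rwalk_steps (G : groupType) (Omega : Type) (s : nat -> Omega -> G) n w :
  rwalk s n w = wprod (steps s n w).
Proof. by rewrite /rwalk /wprod /steps big_map -[in iota 0 n](subn0 n)
  big_mkord. Qed.

Lemma take_steps (G : groupType) (Omega : Type) (s : nat -> Omega -> G) i n w :
  (i <= n)%N -> take i (steps s n w) = steps s i w.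
Proof. by move=> lein; rewrite /steps -map_take take_iota (minn_idPl lein). Qed.

Theorem theorem4p2 (R : realType) (X : metricType R) (PP : set (set X))
  (proj : set X -> X -> X) (nu rho : R)
  (G : groupType) (act : G -> X -> X) (mu : G -> R)
  (d : measure_display) (Omega : measurableType d) (Pr : probability Omega R)
  (s : nat -> Omega -> G) (o : X) :
  relatively_hyperbolic PP ->
  coarse_projection PP proj ->
  trans_constants PP proj nu rho ->
  finitely_generated G ->
  isometric_action act ->
  (forall g P, PP P -> PP (act g @` P)) ->
  (exists P Q, [/\ PP P, PP Q & P <> Q]) ->
  (forall P, PP P -> unbounded_orbits act (stabiliser act P)) ->
  fin_supp_probability mu ->
  (forall g, mu (g^-1)%g = mu g) ->
  generates (msupport mu) ->
  iid_with_law Pr mu s ->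
  linear_progress Pr act (rwalk s) o ->
  forall (p : X) (k : R), 1 <= k ->
    (exists C : R, forall n : nat, (1 <= n)%N ->
      (Pr [set w |
         (C * ln n%:R)%:E <=
         ereal_sup [set dHaus [set act (rwalk s i w) p | i in [set i | (i <= n)%N]]
                              (trans PP nu rho p (act (rwalk s n w) p) g)
                   | g in geodesic p (act (rwalk s n w) p)]]
       <= (C * n%:R `^ (- k))%:E)%E) /\
    (exists C : R, forall n : nat, (1 <= n)%N ->
      (Pr [set w |
         (C * ln n%:R)%:E <=
         ereal_sup [set dHaus [set act (rwalk s i w) p | i in [set i | (i <= n)%N]]
                              (geodesic_seg p (act (rwalk s n w) p) g)
                   | g in geodesic p (act (rwalk s n w) p)]]
       <= (C * n%:R `^ (- k))%:E)%E).
Proof.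
move=> [geoX _] projP consts _ isom act_PP two stab suppP mu_sym gen iid prog p
  k k1.
have [c [D [ps rho0 D0 thin]]] :=
  trans_constants_projection_system geoX projP consts.
have [mu_ge0 _ _] := suppP.
have [S S_uniq [SE mu_sum mu_gt0]] := finite_support_seq suppP.
have SV g : g \in S -> g^-1%g \in S.
  have inS h : (h \in S) = (mu h != 0).
    have : msupport mu h = [set` S] h by rewrite SE.
    by rewrite /msupport /= => hS; apply/idP/idP; rewrite hS.
  by rewrite !inS mu_sym.
have words_gen : forall g, exists2 l, {subset l <= S} & wprod l = g.
  by apply: generates_words SV _; rewrite -SE.
have Gcount := words_countable words_gen.
have PPcount := peripheral_countable ps isom act_PP stab p Gcount.
have three := peripheral_three ps isom act_PP stab p two words_gen.
have PrE := Pr_steps mu_sum S_uniq Gcount iid.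
have [C0 C01 progC0] := prog.
have progress n : Pw S mu n (fun l => mdist o (act (wprod l) o) <= n%:R / C0) <=
    C0 * expR (- (n%:R / C0)).
  rewrite -lee_fin -PrE; apply: le_trans (progC0 n).
  by under eq_set do rewrite -rwalk_steps.
have [B [C tail]] := tracking_tail ps PPcount rho0 D0 thin isom act_PP mu_sum
  mu_ge0 mu_gt0 three p C01 progress k1.
have path_eq n w : [set act (rwalk s i w) p | i in [set i | (i <= n)%N]] =
    walk_path act p n (steps s n w).
  apply/seteqP; split=> _ [i /= lein <-]; exists i => //=.
    by rewrite take_steps// -rwalk_steps.
  by rewrite take_steps// -rwalk_steps.
(* [T] stands for either the transient set or the whole geodesic. *)
have main (T : X -> X -> (R -> X) -> set X) :
    (forall n x l, tracked PP nu rho act p n x l -> forall g,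
       geodesic p (act (wprod l) p) g ->
       (dHaus (walk_path act p n l) (T p (act (wprod l) p) g) <= x%:E)%E) ->
    exists C : R, forall n : nat, (1 <= n)%N ->
      (Pr [set w | (C * ln n%:R)%:E <= ereal_sup [set
         dHaus [set act (rwalk s i w) p | i in [set i | (i <= n)%N]]
           (T p (act (rwalk s n w) p) g)
         | g in geodesic p (act (rwalk s n w) p)]]
       <= (C * n%:R `^ (- k))%:E)%E.
  (* The 1 settles [n = 1], where the logarithm vanishes and the bound has to be trivial; [B + 1]
     makes the event with a weak inequality incompatible with tracking at [B * ln n%:R]. *)
  move=> trT; pose C' := Num.max 1 (Num.max C (B + 1)).
  exists C' => n n1.
  pose A l : Prop := ((C' * ln n%:R)%:E <= ereal_sup [set
     dHaus (walk_path act p n l) (T p (act (wprod l) p) g)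
       | g in geodesic p (act (wprod l) p)])%E.
  rewrite (_ : [set w | _] = [set w | A (steps s n w)]); last first.
    by apply/seteqP; split=> w /=; rewrite /A path_eq rwalk_steps.
  rewrite (PrE n A) lee_fin.
  have [n2|] := leqP 2 n; last first.
    move=> n_lt2; have -> : n = 1%N by apply/eqP; rewrite eqn_leq n1 andbT.
    rewrite powR1 mulr1; apply: le_trans (Pw_le1 mu_ge0 mu_sum _ _) _.
    by rewrite le_max lexx.
  apply: (@le_trans _ _ (C * n%:R `^ (- k))); last first.
    by rewrite ler_wpM2r ?powR_ge0// !le_max lexx orbT.
  apply: le_trans (tail n n2); apply: Pw_sub => // l _ Al tr.
  have x0 : 0 < ln n%:R :> R by rewrite ln_gt0// ltr1n.
  have : (ereal_sup [set dHaus (walk_path act p n l) (T p (act (wprod l) p) g)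
      | g in geodesic p (act (wprod l) p)] <= (B * ln n%:R)%:E)%E.
    by apply: ge_ereal_sup => _ [g gg <-]; exact: trT tr g gg.
  move=> /(le_trans Al); rewrite lee_fin ler_pM2r// leNgt.
  by rewrite /C' !lt_max ltrDl ltr01 !orbT.
split.
- by apply: main => n x l tr g /tr[].
- by apply: (main (fun x y g => geodesic_seg x y g)) => n x l tr g /tr[].
Qed.
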